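(* Let $\widetilde{G}$ be a mixed unicyclic graph with (unique) cycle $\widetilde{C_q}$ on $q$ vertices. Then $$(p^{+}(\widetilde{G}), n^{-}(\widetilde{G})) = \begin{cases} (m(\widetilde{G})-1,\ m(\widetilde{G})-1), & \text{if } q \text{ and } \sigma(\widetilde{C_q}) \text{ are even, } |\sigma(\widetilde{C_q})-q|\equiv 0 \pmod 4 \\ & \text{and no maximum matching of } \widetilde{G} \text{ contains an edge incident to the cycle;}\\ (m(\widetilde{G})+1,\ m(\widetilde{G})), & \text{if } q \text{ is odd, } \sigma(\widetilde{C_q}) \text{ is even, } |\sigma(\widetilde{C_q})-q|\equiv 1 \pmod 4 \\ & \text{and } m(\widetilde{G})=m(\widetilde{G}-V(\widetilde{C_q}))+\frac{q-1}{2};\\ (m(\widetilde{G}),\ m(\widetilde{G})+1), & \text{if } q \text{ is odd, } \sigma(\widetilde{C_q}) \text{ is even, } |\sigma(\widetilde{C_q})-q|\equiv 3 \pmod 4 \\ & \text{and } m(\widetilde{G})=m(\widetilde{G}-V(\widetilde{C_q}))+\frac{q-1}{2};\\ (m(\widetilde{G}),\ m(\widetilde{G})), & \text{otherwise.}\end{cases}$$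
   Context: All graphs are finite, without loops or multiple edges. A mixed graph $\widetilde{G}$ is obtained from an undirected graph $G$ (its underlying graph) by orienting some of the edges of $G$. If $\widetilde{G}$ has vertices $v_1,\dots,v_n$, its Hermitian adjacency matrix is the $n\times n$ matrix $H(\widetilde{G})=(h_{kl})$ with $h_{kl}=-h_{lk}=\mathbf{i}$ (the imaginary unit) if there is an arc from $v_k$ to $v_l$, $h_{kl}=h_{lk}=1$ if $v_k,v_l$ are joined by an undirected edge, and $h_{kl}=0$ otherwise. $H(\widetilde{G})$ is Hermitian; $p^{+}(\widetilde{G})$ and $n^{-}(\widetilde{G})$ denote the numbers of positive and negative eigenvalues of $H(\widetilde{G})$ (with multiplicity). The matching number $m(\widetilde{G})$ is the maximum cardinality of a matching of the underlying graph; a maximum matching is a matching of that cardinality. A mixed cycle is a mixed graph whose underlying graph is a cycle. The signature of a mixed cycle $\widetilde{C}$ is $\sigma(\widetilde{C})=|f-b|$, where $f$ and $b$ are the numbers of forward-oriented and backward-oriented arcs of $\widetilde{C}$ with respect to a traversal of the cycle (undirected edges are not counted). A mixed graph is unicyclic if its underlying graph contains exactly one cycle. An edge is incident to a cycle if exactly one of its endpoints lies on the cycle. $\widetilde{G}-X$ is the mixed graph obtained by deleting the vertices in $X$ and all incident edges and arcs. *)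

(* Defs.v *)
From HB Require Import structures.
From mathcomp Require Import all_boot all_order all_algebra.

Set Implicit Arguments.
Unset Strict Implicit.
Unset Printing Implicit Defensive.

Import Order.TTheory GRing.Theory Num.Theory.

Local Open Scope ring_scope.

(* [madj] is the adjacency of the underlying simple graph and [marc x y] holds
   when there is an arc from x to y; adjacent vertices with no arc between them
   are joined by an undirected edge. *)
Record mixedGraph (T : finType) := MixedGraph {
  madj : rel T;
  marc : rel T;
  madj_sym : symmetric madj;
  madj_irr : irreflexive madj;
  marc_adj : forall x y, marc x y -> madj x y;
  marc_asym : forall x y, marc x y -> ~~ marc y x }.

Section Inertia.
Variables (C : numClosedFieldType) (n : nat) (A : 'M[C]_n).

(* The eigenvalues, listed with algebraic multiplicity. *)
Definition eigenvalues : seq C := sval (closed_field_poly_normal (char_poly A)).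

(* In a numClosedFieldType, 0 < z entails that z is real. *)
Definition num_pos_eig : nat := count (fun z : C => 0 < z) eigenvalues.
Definition num_neg_eig : nat := count (fun z : C => z < 0) eigenvalues.

End Inertia.

Section MixedGraphs.
Variables (T : finType) (G : mixedGraph T).
Implicit Types (M : {set {set T}}) (c : seq T).

Definition herm_entry (C : numClosedFieldType) (x y : T) : C :=
  if marc G x y then 'i
  else if marc G y x then - 'i
  else if madj G x y then 1
  else 0.

Definition herm_adj (C : numClosedFieldType) : 'M[C]_#|T| :=
  \matrix_(k, l) herm_entry C (enum_val k) (enum_val l).

Definition edges : {set {set T}} :=
  [set [set u.1; u.2] | u in [set u : T * T | madj G u.1 u.2]].

Definition is_matching M : bool := (M \subset edges) && trivIset M.

Definition matching_number : nat := (\max_(M | is_matching M) #|M|)%N.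

Definition is_max_matching M : bool :=
  is_matching M && (#|M| == matching_number).

Definition is_cycle c : bool := (2 < size c)%N && ucycleb (madj G) c.

(* Distinct vertex sequences traverse the same cycle exactly when their edge
   sets coincide. *)
Definition cycle_edges c : {set {set T}} :=
  [set [set x; next c x] | x in c].

Definition is_unique_cycle c : Prop :=
  is_cycle c /\ forall c', is_cycle c' -> cycle_edges c' = cycle_edges c.

Definition forward_arcs c : nat := count (fun x => marc G x (next c x)) c.
Definition backward_arcs c : nat := count (fun x => marc G (next c x) x) c.

Definition signature c : nat :=
  `|(forward_arcs c)%:Z - (backward_arcs c)%:Z|%N.

Definition incident_to_cycle c (e : {set T}) : bool :=
  (e \in edges) && (#|e :&: [set x in c]| == 1%N).

Definition max_matchings_avoid_incident c : bool :=
  [forall (M | is_max_matching M), forall (e | e \in M),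
     ~~ incident_to_cycle c e].

End MixedGraphs.

Section Deletion.
Variables (T : finType) (G : mixedGraph T) (X : {set T}).

Let S : finType := {x : T | x \notin X}.
Let adjX : rel S := fun x y => madj G (val x) (val y).
Let arcX : rel S := fun x y => marc G (val x) (val y).

Fact del_adj_sym : symmetric adjX.
Proof. by move=> x y; apply: madj_sym. Qed.

Fact del_adj_irr : irreflexive adjX.
Proof. by move=> x; apply: madj_irr. Qed.

Fact del_arc_adj x y : arcX x y -> adjX x y.
Proof. exact: marc_adj. Qed.

Fact del_arc_asym x y : arcX x y -> ~~ arcX y x.
Proof. exact: marc_asym. Qed.

Definition del_vertices : mixedGraph {x : T | x \notin X} :=
  MixedGraph del_adj_sym del_adj_irr del_arc_adj del_arc_asym.

End Deletion.

(* Main.v *)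
Require Import Defs.
From HB Require Import structures.
From mathcomp Require Import all_boot all_order all_algebra.
From mathcomp Require Import ring zify.

Set Implicit Arguments.
Unset Strict Implicit.
Unset Printing Implicit Defensive.

Import Order.TTheory GRing.Theory Num.Theory.

Local Open Scope ring_scope.

(** By Sylvester's law the inertia of the Hermitian adjacency matrix does not
    change under congruence.  Eliminating two adjacent vertices [u], [v] whose
    diagonal entries vanish splits off a block of inertia [(1, 1)] and leaves
    the Schur complement.  If [u] has degree one, this complement is the
    matrix of the graph without [u] and [v].  Repeating this until no vertex of
    degree one is left gives a set [V] of neighbours and a matching of the same
    size, and what remains is either edgeless or the cycle plus isolated
    vertices.

    In the edgeless case [V] covers every edge, so the matching number is [#|V|]
    and the inertia is [(#|V|, #|V|)]; some removed pair was incident to the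
    cycle, and at least half of the cycle lies in [V].  In the other case [V]
    covers exactly the edges outside the cycle, so the matching number is
    [#|V| + q./2] and that of the graph without the cycle is [#|V|]; counting
    each vertex of [V] twice and each vertex of the cycle once shows that for
    even [q] no maximum matching uses an edge incident to the cycle.  The
    inertia of the cycle itself is found by eliminating two adjacent vertices
    at a time: this shortens the cycle by two and changes the sign of the
    product of its weights, which is a power of [i] given by the signature. *)

(** * Sylvester's law of inertia *)

Section Sylvester.
Local Open Scope sesquilinear_scope.
Variable C : numClosedFieldType.

(** Similarity preserves the characteristic polynomial, and a product of linear factors determines
    its roots up to order, so the eigenvalues are a permutation of the diagonal. *)
Lemma count_eigenvalues_similar_diag n (P : 'M[C]_n) (d : 'rV[C]_n) (q : pred C) :
  P \in unitmx ->
  count q (eigenvalues (invmx P *m diag_mx d *m P)) = #|[pred i | q (d 0 i)]|.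
Proof.
move=> uP; rewrite /eigenvalues.
set cp := char_poly _; case: (closed_field_poly_normal cp) => s /= cpE.
have cpd : cp = \prod_(z <- [seq d 0 i | i <- enum 'I_n]) ('X - z%:P).
  have -> : cp = char_poly (diag_mx d).
    rewrite /cp /char_poly.
    have -> : char_poly_mx (invmx P *m diag_mx d *m P) =
        map_mx polyC (invmx P) *m char_poly_mx (diag_mx d) *m map_mx polyC P.
      rewrite /char_poly_mx mulmxBr mulmxBl -!map_mxM; congr (_ - _).
      by rewrite scalar_mxC -mulmxA -map_mxM mulVmx // map_mx1 mulmx1.
    rewrite !det_mulmx mulrC mulrA -det_mulmx -map_mxM mulmxV //.
    by rewrite map_mx1 det1 mul1r.
  rewrite char_poly_trig; last by exact/is_diag_mx_is_trig/diag_mx_is_diag.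
  by rewrite big_map big_enum /=; apply: eq_bigr => i _; rewrite mxE eqxx mulr1n.
have : perm_eq s [seq d 0 i | i <- enum 'I_n].
  move: cpE; rewrite (monicP (char_poly_monic _)) scale1r cpd => /esym.
  exact: prod_XsubC_eq.
move/permP => ->; rewrite count_map -sum1_count big_enum_cond /= sum1_card.
by apply: eq_card.
Qed.

Lemma real_nonpos (x : C) : x \is Num.real -> ~~ (0 < x) -> x <= 0.
Proof. by move=> xr; rewrite real_ltNge ?real0 // negbK. Qed.

(* A nonzero vector supported on the positive entries of d2, and whose image
   under Q is supported on the nonpositive entries of d1, would have a norm
   of both signs. *)
Lemma card_pos_congr_diag n (Q : 'M[C]_n) (d1 d2 : 'rV[C]_n) :
  d1 \is a realmx ->
  Q *m diag_mx d1 *m Q^t* = diag_mx d2 ->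
  (#|[pred i | (0 < d2 0 i)%R]| <= #|[pred i | (0 < d1 0 i)%R]|)%N.
Proof.
move=> d1r QE; rewrite leqNgt; apply/negP => lt12.
set p1 := [pred i | 0 < d1 0 i] in lt12; set p2 := [pred i | 0 < d2 0 i] in lt12.
pose f (i : 'I_#|[predC p2]|) := enum_val i.
pose g (i : 'I_#|p1|) := enum_val i.
pose M := row_mx (colsub f (1%:M : 'M[C]_n)) (colsub g Q).
(* As [p1] is smaller than [p2], [M] has fewer than [n] columns, so some nonzero row vector
   annihilates both blocks. *)
have : kermx M != 0.
  rewrite kermx_eq0 /row_free neq_ltn; apply/orP; left.
  apply: leq_ltn_trans (rank_leq_col M) _.
  by rewrite -[X in (_ < X)%N](card_ord n) -(cardC p2) addnC ltn_add2r.
case/rowV0Pn => y /sub_kermxP; rewrite mul_mx_row => /eqP.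
rewrite row_mx_eq0 => /andP[/eqP y2 /eqP y1] y0.
have y2E i : ~~ p2 i -> y 0 i = 0.
  move=> pi; have ii : i \in [predC p2] by [].
  move/matrixP/(_ 0 (enum_rank_in ii i)): y2; rewrite !mxE.
  under eq_bigr do rewrite !mxE /f enum_rankK_in //.
  rewrite (bigD1 i) //= eqxx mulr1 big1 ?addr0 // => j /negbTE->.
  by rewrite mulr0.
have y1E i : p1 i -> (y *m Q) 0 i = 0.
  move=> pi; have ii : i \in p1 by [].
  move/matrixP/(_ 0 (enum_rank_in ii i)): y1; rewrite !mxE.
  by under eq_bigr do rewrite !mxE /g enum_rankK_in //.
have formE (z d : 'rV[C]_n) :
    (z *m diag_mx d *m z^t*) 0 0 = \sum_i d 0 i * `|z 0 i| ^+ 2.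
  rewrite mxE; apply: eq_bigr => i _; rewrite mul_mx_diag !mxE.
  by rewrite normCK mulrAC [RHS]mulrC.
have : (y *m diag_mx d2 *m y^t*) 0 0 = (y *m Q *m diag_mx d1 *m (y *m Q)^t*) 0 0.
  by rewrite -QE trmx_mul map_mxM !mulmxA.
rewrite !formE => E.
have le0 : \sum_i d1 0 i * `|(y *m Q) 0 i| ^+ 2 <= 0.
  apply: sumr_le0 => i _; have [pi|npi] := boolP (p1 i).
    by rewrite y1E // normr0 expr0n mulr0.
  by apply: mulr_le0_ge0; rewrite ?exprn_ge0 // real_nonpos //; apply/mxOverP.
have /rV0Pn[i yi] := y0.
have pi : p2 i by apply: contraNT yi => /y2E ->.
move: le0; rewrite -E; apply/negP; rewrite lt_geF //.
rewrite (bigD1 i) //=; apply: ltr_wpDr; last first.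
  by rewrite mulr_gt0 // exprn_gt0 // normr_gt0.
apply: sumr_ge0 => j _; have [pj|npj] := boolP (p2 j).
  by rewrite mulr_ge0 ?exprn_ge0 // ltW.
by rewrite y2E // normr0 expr0n mulr0.
Qed.

Definition herm_mx n (A : 'M[C]_n) := A^t* = A.

Lemma herm_mx_spectral n (A : 'M[C]_n) : herm_mx A ->
  exists2 Pd : 'M[C]_n * 'rV[C]_n, Pd.1 \is unitarymx & Pd.2 \is a realmx /\
    A = invmx Pd.1 *m diag_mx Pd.2 *m Pd.1.
Proof.
move=> hA; have hs : A \is hermsymmx by apply/is_hermitianmxP; rewrite expr0 scale1r.
exists (spectralmx A, spectral_diag A); first exact: spectral_unitarymx.
split; first exact: hermitian_spectral_diag_real.
exact/orthomx_spectralP/hermitian_normalmx.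
Qed.

Lemma herm_mx_congr n (P A : 'M[C]_n) : herm_mx A -> herm_mx (P *m A *m P^t*).
Proof. by rewrite /herm_mx !trmx_mul !map_mxM trmxCK -mulmxA => ->; rewrite mulmxA. Qed.

(** Unitary diagonalisation of both matrices turns the congruence by [P] into one by [Q] between
    real diagonal matrices. Negative eigenvalues are handled by negating both diagonals. *)
Lemma num_eig_congr_leq n (P A : 'M[C]_n) : herm_mx A ->
  (num_pos_eig (P *m A *m P^t*) <= num_pos_eig A)%N /\
  (num_neg_eig (P *m A *m P^t*) <= num_neg_eig A)%N.
Proof.
move=> hA; have hB := herm_mx_congr P hA.
set B := _ *m _ in hB *.
have [[U d] /= uU [dr AE]] := herm_mx_spectral hA.
have [[V e] /= uV [er BE]] := herm_mx_spectral hB.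
pose Q := V *m P *m invmx U.
have QE : Q *m diag_mx d *m Q^t* = diag_mx e.
  have -> : diag_mx e = V *m B *m V^t*.
    rewrite BE -(invmx_unitary uV) !mulmxA mulmxV ?unitarymx_unit // mul1mx.
    by rewrite -mulmxA mulmxV ?unitarymx_unit // mulmx1.
  rewrite /B AE /Q !trmx_mul !map_mxM -!(invmx_unitary uV) (invmx_unitary uU).
  by rewrite trmxCK !mulmxA.
rewrite /num_pos_eig /num_neg_eig BE AE.
rewrite !(count_eigenvalues_similar_diag _ _ (unitarymx_unit _)) //.
split; first exact: card_pos_congr_diag QE.
have QEN : Q *m diag_mx (- d) *m Q^t* = diag_mx (- e).
  by rewrite !raddfN /= mulNmx QE.
have dNr : - d \is a realmx.
  by apply/mxOverP => i j; rewrite mxE realN; apply/mxOverP.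
have := card_pos_congr_diag dNr QEN.
by congr (_ <= _)%N; apply: eq_card => i; rewrite !inE mxE oppr_gt0.
Qed.

Lemma num_eig_congr n (P A : 'M[C]_n) : herm_mx A -> P \in unitmx ->
  num_pos_eig (P *m A *m P^t*) = num_pos_eig A /\
  num_neg_eig (P *m A *m P^t*) = num_neg_eig A.
Proof.
move=> hA uP.
have [p1 n1] := num_eig_congr_leq P hA.
have [] := num_eig_congr_leq (invmx P) (herm_mx_congr P hA).
have -> : invmx P *m (P *m A *m P^t*) *m (invmx P)^t* = A.
  rewrite !mulmxA mulVmx // mul1mx -mulmxA -map_mxM -trmx_mul mulVmx //.
  by rewrite trmx1 map_mx1 mulmx1.
by move=> p2 n2; split; apply/eqP; rewrite eqn_leq ?p1 ?p2 ?n1 ?n2.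
Qed.

Lemma num_eig_diag n (d : 'rV[C]_n) :
  num_pos_eig (diag_mx d) = #|[pred i | (0 < d 0 i)%R]| /\
  num_neg_eig (diag_mx d) = #|[pred i | (d 0 i < 0)%R]|.
Proof.
have -> : diag_mx d = invmx 1%:M *m diag_mx d *m 1%:M.
  by rewrite invmx1 mul1mx mulmx1.
by split; rewrite /num_pos_eig /num_neg_eig count_eigenvalues_similar_diag // unitmx1.
Qed.

End Sylvester.

(** * Schur complements *)

Section FormInertia.
Local Open Scope sesquilinear_scope.
Variables (C : numClosedFieldType) (T : finType).
Implicit Types (g h p : T -> T -> C) (e : T -> C) (S : {set T}).

Definition form_mx g : 'M[C]_#|T| := \matrix_(k, l) g (enum_val k) (enum_val l).

Definition herm_form g := forall x y, g y x = (g x y)^*.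

Lemma eq_form_mx g h : g =2 h -> form_mx g = form_mx h.
Proof. by move=> E; apply/matrixP => k l; rewrite !mxE E. Qed.

Lemma herm_form_mx g : herm_form g -> herm_mx (form_mx g).
Proof. by move=> hg; apply/matrixP => k l; rewrite !mxE hg conjCK. Qed.

Lemma mul_form_mx g h :
  form_mx g *m form_mx h = form_mx (fun x y => \sum_z g x z * h z y).
Proof.
apply/matrixP => k l; rewrite !mxE [RHS]big_enum_val /=.
by apply: eq_bigr => i _; rewrite !mxE.
Qed.

Lemma form_mx1 : form_mx (fun x y => (x == y)%:R) = 1%:M.
Proof. by apply/matrixP => k l; rewrite !mxE (inj_eq enum_val_inj). Qed.

(** Congruence for kernels indexed by [T]; the right inverse [p'] certifies that the change of basis
    is invertible. *)
Lemma num_eig_form_congr p p' g : herm_form g ->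
  (forall x y, \sum_z p x z * p' z y = (x == y)%:R) ->
  let h := fun x y => \sum_z (\sum_w p x w * g w z) * (p y z)^* in
  num_pos_eig (form_mx h) = num_pos_eig (form_mx g) /\
  num_neg_eig (form_mx h) = num_neg_eig (form_mx g).
Proof.
move=> hg pp' h.
have up : form_mx p \in unitmx.
  apply: (proj1 (mulmx1_unit (_ : _ *m form_mx p' = _))).
  by rewrite mul_form_mx (eq_form_mx pp') form_mx1.
suff -> : form_mx h = form_mx p *m form_mx g *m (form_mx p)^t*.
  exact: num_eig_congr (herm_form_mx hg) up.
have -> : (form_mx p)^t* = form_mx (fun x y => (p y x)^*).
  by apply/matrixP => k l; rewrite !mxE.
by rewrite !mul_form_mx.
Qed.

Lemma num_eig_form_diag e :
  let h := form_mx (fun x y => if x == y then e x else 0) in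
  num_pos_eig h = #|[pred x | (0 < e x)%R]| /\
  num_neg_eig h = #|[pred x | (e x < 0)%R]|.
Proof.
move=> h; pose d : 'rV[C]_#|T| := \row_k e (enum_val k).
have -> : h = diag_mx d.
  apply/matrixP => k l; rewrite !mxE (inj_eq enum_val_inj).
  by case: eqP => // ->.
have count_enum_val (q : pred C) :
    #|[pred i | q (d 0 i)]| = #|[pred x | q (e x)]|.
  transitivity (\sum_(x in T) (q (e x) : nat))%N.
    rewrite big_enum_val -[LHS]sum1_card big_mkcond /=.
    by apply: eq_bigr => i _; rewrite !inE mxE; case: (q _).
  rewrite -[RHS]sum1_card [RHS]big_mkcond.
  by apply: eq_bigr => i _; rewrite !inE; case: (q _).
have [-> ->] := num_eig_diag d.
split; first exact: (count_enum_val (fun z => 0 < z)).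
exact: (count_enum_val (fun z => z < 0)).
Qed.

(** The Schur complement of the block on [u], [v]: with zero diagonal, this block has an
    antidiagonal inverse, which leaves just these two correction terms. *)
Definition schur g (u v x y : T) : C :=
  g x y - g x v * g u y / g u v - g x u * g v y / g v u.

Lemma schur_herm g u v : herm_form g -> herm_form (schur g u v).
Proof.
move=> hg x y; rewrite /schur !rmorphB !rmorphM !fmorphV /= -!hg.
by rewrite -!addrA; congr (_ + _); rewrite addrC; congr (- (_ / _) - (_ / _)); rewrite mulrC.
Qed.

Lemma num_eig_schur g u v : herm_form g -> u != v ->
  g u u = 0 -> g v v = 0 -> g u v != 0 ->
  let h := fun x y =>
    if (x \notin [:: u; v]) && (y \notin [:: u; v]) then schur g u v x y
    else if x == y then (if x == u then 1 else -1) else 0 in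
  num_pos_eig (form_mx h) = num_pos_eig (form_mx g) /\
  num_neg_eig (form_mx h) = num_neg_eig (form_mx g).
Proof.
move=> hg uv guu gvv guv h.
have gvu : g v u != 0 by rewrite hg conjC_eq0.
have vu : (v == u) = false by rewrite eq_sym (negbTE uv).
(* With this [b] the vectors e_u + b e_v and e_u - b e_v are orthogonal for the form and have values
   1 and -1. *)
pose b := (2 * g v u)^-1.
have b0 : b != 0 by rewrite invr_eq0 mulf_neq0 // pnatr_eq0.
pose out x : C := (x \notin [:: u; v])%:R.
pose comb (A B : T -> C) x z : C :=
  out x * (x == z)%:R + A x * (z == u)%:R + B x * (z == v)%:R.
have combE A B x (f : T -> C) :
    \sum_z comb A B x z * f z = out x * f x + A x * f u + B x * f v.
  under eq_bigr do rewrite /comb !mulrDl.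
  rewrite !big_split /=; congr (_ + _ + _).
  - rewrite (bigD1 x) //= eqxx mulr1 big1 ?addr0 // => z /negbTE.
    by rewrite eq_sym => ->; rewrite mulr0 mul0r.
  - rewrite (bigD1 u) //= eqxx mulr1 big1 ?addr0 // => z /negbTE ->.
    by rewrite mulr0 mul0r.
  - rewrite (bigD1 v) //= eqxx mulr1 big1 ?addr0 // => z /negbTE ->.
    by rewrite mulr0 mul0r.
(* Adding [al x] times e_u and [be x] times e_v to e_x makes it orthogonal to both e_u and e_v. *)
pose al x := - g x v / g u v.
pose be x := - g x u / g v u.
pose A x := if x == u then 1 else if x == v then 1 else al x.
pose B x := if x == u then b else if x == v then - b else be x.
(* The inverse change of basis: e_u is half the sum of the two new vectors, e_v their difference
   divided by 2b. *)
pose A' x := if x == u then 2^-1 else if x == v then (2 * b)^-1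
             else - al x / 2 - be x / (2 * b).
pose B' x := if x == u then 2^-1 else if x == v then - (2 * b)^-1
             else - al x / 2 + be x / (2 * b).
pose p := comb A B; pose p' := comb A' B'.
have outu : out u = 0 by rewrite /out !inE eqxx.
have outv : out v = 0 by rewrite /out !inE eqxx orbT.
have Au : A u = 1 by rewrite /A eqxx.
have Av : A v = 1 by rewrite /A eqxx vu.
have Bu : B u = b by rewrite /B eqxx.
have Bv : B v = - b by rewrite /B eqxx vu.
have two0 : (2 : C) != 0 by rewrite pnatr_eq0.
have pp' x y : \sum_z p x z * p' z y = (x == y)%:R.
  rewrite combE /p' /comb outu outv /A' /B' !eqxx vu /A /B.
  have [->|xu] := eqVneq x u.
    rewrite outu (eq_sym u y) (eq_sym y v); case: (eqVneq y u) => [->|_] /=.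
      by rewrite ?vu /=; field; rewrite ?b0.
    by case: (v == y) => /=; field; rewrite ?b0.
  have [->|xv] := eqVneq x v.
    rewrite outv; case: (eqVneq y u) => [->|yu] /=.
      by rewrite ?vu ?(negbTE uv) /=; field; rewrite ?b0.
    by rewrite (eq_sym y); case: (v == y) => /=; field; rewrite ?b0.
  have -> : out x = 1 by rewrite /out !inE negb_or xu xv.
  by field; rewrite ?b0.
have [<- <-] := num_eig_form_congr hg pp'.
suff E : h =2 (fun x y => \sum_z (\sum_w p x w * g w z) * (p y z)^*) by rewrite (eq_form_mx E).
have pcE y (f : T -> C) :
    \sum_z f z * (p y z)^* = out y * f y + (A y)^* * f u + (B y)^* * f v.
  rewrite -[LHS]conjCK rmorph_sum /=.
  under eq_bigr do rewrite rmorphM /= conjCK mulrC.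
  by rewrite combE !rmorphD !rmorphM /= !conjCK conjC_nat.
move=> x y; rewrite pcE !combE.
have bc : b^* = (2 * g u v)^-1 by rewrite fmorphV rmorphM /= conjC_nat (hg u v) conjCK.
have Aout z : z != u -> z != v -> A z = - g z v / g u v by rewrite /A => /negbTE-> /negbTE->.
have Bout z : z != u -> z != v -> B z = - g z u / g v u by rewrite /B => /negbTE-> /negbTE->.
have Ac z : z != u -> z != v -> (A z)^* = - g v z / g v u.
  by move=> zu zv; rewrite Aout // rmorphM ?rmorphN fmorphV /= -!hg.
have Bc z : z != u -> z != v -> (B z)^* = - g u z / g u v.
  by move=> zu zv; rewrite Bout // rmorphM ?rmorphN fmorphV /= -!hg.
have Bvc : (B v)^* = - (2 * g u v)^-1 by rewrite Bv rmorphN /= bc.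
have Buc : (B u)^* = (2 * g u v)^-1 by rewrite Bu bc.
have Auc : (A u)^* = 1 by rewrite Au rmorph1.
have Avc : (A v)^* = 1 by rewrite Av rmorph1.
have outE z : z != u -> z != v -> out z = 1.
  by rewrite /out !inE negb_or => -> ->.
rewrite /h !inE !negb_or /schur.
have [->|xu] := eqVneq x u.
  rewrite /= outu Au Bu; have [->|yu] := eqVneq y u.
    by rewrite outu guu gvv Auc Buc /b; field; rewrite guv gvu.
  have [->|yv] := eqVneq y v.
    by rewrite ?(negbTE uv) outv Avc Bvc guu gvv /b; field; rewrite guv gvu.
  by rewrite ?[u == y]eq_sym ?(negbTE yu) Ac // Bc // outE // guu gvv /b; field; rewrite guv gvu.
have [->|xv] := eqVneq x v.
  rewrite /= outv Av Bv; have [->|yu] := eqVneq y u.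
    by rewrite vu outu guu gvv Auc Buc /b; field; rewrite guv gvu.
  have [->|yv] := eqVneq y v.
    by rewrite ?eqxx outv Avc Bvc guu gvv /b; field; rewrite guv gvu.
  by rewrite ?[v == y]eq_sym ?(negbTE yv) Ac // Bc // outE // guu gvv /b; field; rewrite guv gvu.
rewrite Aout // Bout // (outE x) //=.
have [->|yu] := eqVneq y u.
  by rewrite ?(negbTE xu) outu guu gvv Auc Buc /=; field; rewrite guv gvu.
have [->|yv] := eqVneq y v.
  by rewrite ?(negbTE xv) outv guu gvv Avc Bvc /=; field; rewrite guv gvu.
by rewrite Ac // Bc // outE //= guu gvv; field; rewrite guv gvu.
Qed.

End FormInertia.

(** * Inertia of the restriction to a set of vertices *)

Section Restriction.
Variables (C : numClosedFieldType) (T : finType).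
Implicit Types (g h p : T -> T -> C) (e : T -> C) (S : {set T}).

Definition restrict_form g S e x y : C :=
  if (x \in S) && (y \in S) then g x y else if x == y then e x else 0.

(* Quantifying over the diagonal completion [e] makes the inertia of the
   restriction to S available without changing the index type. *)
Definition has_inertia g S (a b : nat) := forall e, (forall x, e x \is Num.real) ->
  num_pos_eig (form_mx (restrict_form g S e)) =
    (a + #|[pred x | (x \notin S) && (0 < e x)%R]|)%N /\
  num_neg_eig (form_mx (restrict_form g S e)) =
    (b + #|[pred x | (x \notin S) && (e x < 0)%R]|)%N.

Lemma has_inertia_setT g a b : has_inertia g setT a b ->
  num_pos_eig (form_mx g) = a /\ num_neg_eig (form_mx g) = b.
Proof.
move/(_ (fun=> 0)) => []; first by move=> x; apply: real0.
have -> : form_mx (restrict_form g setT (fun=> 0)) = form_mx g.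
  by apply: eq_form_mx => x y; rewrite /restrict_form !inE.
by move=> [-> ->]; split; rewrite eq_card0 ?addn0 // => x; rewrite !inE.
Qed.

Lemma eq_has_inertia g h S a b : {in S &, g =2 h} ->
  has_inertia g S a b -> has_inertia h S a b.
Proof.
move=> E gI e er; have [<- <-] := gI e er.
suff -> : form_mx (restrict_form h S e) = form_mx (restrict_form g S e) by [].
apply: eq_form_mx => x y; rewrite /restrict_form.
by case: ifP => // /andP[xS yS]; rewrite E.
Qed.

Lemma has_inertia_diag g S : {in S &, forall x y, x != y -> g x y = 0} ->
  {in S, forall x, g x x \is Num.real} ->
  has_inertia g S #|[pred x in S | (0 < g x x)%R]| #|[pred x in S | (g x x < 0)%R]|.
Proof.
move=> g0 gr e er.
pose d x := if x \in S then g x x else e x.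
have -> : form_mx (restrict_form g S e) = form_mx (fun x y => if x == y then d x else 0).
  apply: eq_form_mx => x y; rewrite /restrict_form /d.
  have [->|xy] := eqVneq x y; first by case: (y \in S).
  by case: ifP => // /andP[xS yS]; rewrite g0.
have [-> ->] := num_eig_form_diag d.
have split_card (q : pred C) : #|[pred x | q (d x)]| =
   (#|[pred x in S | q (g x x)]| + #|[pred x | (x \notin S) && q (e x)]|)%N.
  rewrite -(cardID (mem S)); congr (_ + _)%N; apply: eq_card => x; rewrite !inE /d;
  by case: (x \in S); rewrite ?andbT ?andbF.
by split; [apply: (split_card (fun z => 0 < z)) | apply: (split_card (fun z => z < 0))].
Qed.

Lemma has_inertia0 g S : {in S &, forall x y, g x y = 0} -> has_inertia g S 0 0.
Proof.
move=> g0; have := @has_inertia_diag g S.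
rewrite !eq_card0 => [|x|x]; first apply; first by move=> x y xS yS _; apply: g0.
- by move=> x xS; rewrite g0 // real0.
- by rewrite !inE; case: (boolP (x \in S)) => // xS; rewrite g0 // ltxx.
- by rewrite !inE; case: (boolP (x \in S)) => // xS; rewrite g0 // ltxx.
Qed.

(** The extra vertices have zero rows, so they amount to diagonal entries 0, which neither count
    sees; hence the completion [e']. *)
Lemma has_inertia_widen g (S S' : {set T}) a b : S' \subset S ->
  {in S :\: S', forall x, {in S, forall y, g x y = 0 /\ g y x = 0}} ->
  has_inertia g S' a b -> has_inertia g S a b.
Proof.
move=> sS g0 gI e er; pose e' x := if x \in S then 0 else e x.
have e'r x : e' x \is Num.real by rewrite /e'; case: ifP; rewrite ?real0.
have -> : form_mx (restrict_form g S e) = form_mx (restrict_form g S' e').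
  apply: eq_form_mx => x y; rewrite /restrict_form /e'.
  have [xS'|xS'] := boolP (x \in S'); have [yS'|yS'] := boolP (y \in S') => /=.
  - by rewrite !(subsetP sS).
  - have xS := subsetP sS _ xS'; rewrite xS /=; case: ifP => yS.
      by have [|_ ->] := g0 y _ x xS; rewrite ?inE ?yS ?yS' //; case: ifP.
    by case: eqP => // xy; rewrite -xy xS in yS.
  - have yS := subsetP sS _ yS'; rewrite yS andbT.
    case: ifP => xS.
      by have [|-> _] := g0 x _ y yS; rewrite ?inE ?xS ?xS' //; case: ifP.
    by case: eqP => // xy; rewrite xy yS in xS.
  - case: (boolP (x \in S)) => xS /=; last by case: eqP.
    case: (boolP (y \in S)) => yS /=.
      by have [|-> _] := g0 x _ y yS; rewrite ?inE ?xS ?xS' //; case: ifP.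
    by case: eqP => // xy; rewrite -xy xS in yS.
have [-> ->] := gI e' e'r; split; congr (_ + _)%N; apply: eq_card => x; rewrite !inE /e'.
all: by case: (boolP (x \in S)) => xS /=; rewrite ?ltxx ?andbF // (contra (subsetP sS x)).
Qed.

(** The entries 1 and -1 split off at [u] and [v] are absorbed into the diagonal completion [e'],
    where they account for one more positive and one more negative eigenvalue. *)
Lemma has_inertia_schur g S u v a b : herm_form g -> u != v ->
  u \in S -> v \in S -> g u u = 0 -> g v v = 0 -> g u v != 0 ->
  has_inertia (schur g u v) (S :\: [set u; v]) a b ->
  has_inertia g S a.+1 b.+1.
Proof.
move=> hg uv uS vS guu gvv guv gI e er.
have vu : v != u by rewrite eq_sym.
pose h := restrict_form g S e.
have hE x y : x \in S -> y \in S -> h x y = g x y by rewrite /h /restrict_form => -> ->.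
have hh : herm_form h.
  move=> x y; rewrite /h /restrict_form andbC (eq_sym y x).
  case: ifP => _; first exact: hg.
  by case: eqP => [->|]; rewrite ?conjC0 //; apply/esym/CrealP.
have := num_eig_schur hh uv; rewrite !hE // => /(_ guu gvv guv)[<- <-].
pose e' x := if x == u then 1 else if x == v then -1 else e x.
have e'r x : e' x \is Num.real.
  by rewrite /e'; case: ifP => _; rewrite ?real1 //; case: ifP; rewrite ?realN ?real1.
set k := form_mx _.
have -> : k = form_mx (restrict_form (schur g u v) (S :\: [set u; v]) e').
  apply: eq_form_mx => x y; rewrite /restrict_form !inE !negb_or.
  have [->|xu] := eqVneq x u; first by rewrite /= /e' eqxx.
  have [->|xv] := eqVneq x v; first by rewrite /= /e' ?eqxx ?(negbTE vu) ?andbF.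
  have [->|yu] /= := eqVneq y u; first by rewrite (negbTE xu) andbF.
  have [->|yv] /= := eqVneq y v; first by rewrite (negbTE xv) andbF.
  rewrite /schur (hE u v) // (hE v u) //.
  (* Outside [S] the completed matrix is diagonal, so the elimination leaves those rows
     unchanged. *)
  have hout x' y' : x' \notin S -> y' != x' -> h x' y' = 0 /\ h y' x' = 0.
    move=> x'S yx; rewrite /h /restrict_form (negbTE x'S) /= andbF.
    by rewrite (negbTE yx) eq_sym (negbTE yx).
  have [xS|xS] := boolP (x \in S); last first.
    have [-> _] : h x v = 0 /\ h v x = 0 by apply: hout; rewrite // eq_sym.
    have [-> _] : h x u = 0 /\ h u x = 0 by apply: hout; rewrite // eq_sym.
    rewrite !mul0r !subr0 /h /restrict_form (negbTE xS) /= /e'.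
    by rewrite (negbTE xu) (negbTE xv).
  have [yS|yS] := boolP (y \in S); first by rewrite !hE.
  have [_ ->] : h y u = 0 /\ h u y = 0 by apply: hout; rewrite // eq_sym.
  have [_ ->] : h y v = 0 /\ h v y = 0 by apply: hout; rewrite // eq_sym.
  rewrite !mulr0 !mul0r !subr0 /h /restrict_form (negbTE yS) andbF /= /e'.
  by rewrite (negbTE xu) (negbTE xv).
have [-> ->] := gI e' e'r.
split; rewrite addSnnS; congr (_ + _)%N.
  rewrite (cardD1 u) !inE eqxx /= /e' eqxx ltr01 add1n; congr _.+1.
  apply: eq_card => x; rewrite !inE negb_and negbK.
  have [->|xu] /= := eqVneq x u; first by rewrite uS.
  by have [->|xv] /= := eqVneq x v; rewrite ?vS ?ltr0N1 //= oppr_gt0 ltr10.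
rewrite (cardD1 v) !inE eqxx orbT /= /e' eqxx (negbTE vu) ltrN10 add1n; congr _.+1.
apply: eq_card => x; rewrite !inE negb_and negbK.
have [->|xv] /= := eqVneq x v; first by rewrite vS.
by have [->|xu] /= := eqVneq x u; rewrite ?uS ?ltr10.
Qed.

End Restriction.

(** * Inertia of a weighted cycle *)

Section CycleInertia.
Variables (C : numClosedFieldType) (T : finType).
Implicit Types (g : T -> T -> C) (s : seq T) (w : nat -> C) (k : C).

(* Path weights [w] plus a closing weight [k] between the two ends.  The two
   contributions add up when they meet, i.e. when [r] is 1 or 2; this is what
   lets the elimination of two adjacent vertices stay within this shape. *)
Definition closed_path_weight w k r (i j : nat) : C :=
  (j == i.+1)%:R * w i + (i == j.+1)%:R * (w j)^*
  + ((i == 0%N) && (j == r.-1))%:R * k + ((i == r.-1) && (j == 0%N))%:R * k^*.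

Definition closed_path_form g s w k := forall x0 i j,
  (i < size s)%N -> (j < size s)%N ->
  g (nth x0 s i) (nth x0 s j) = closed_path_weight w k (size s) i j.

(** Among the remaining vertices, [v] meets only the first of [s] and [u] only the last. The
    correction therefore touches only the pair of ends of [s] and becomes the new closing weight;
    the path weights shift by two. *)
Lemma schur_closed_path g u v s w k :
  (0 < size s)%N -> closed_path_form g [:: u, v & s] w k ->
  closed_path_form (schur g u v) s (fun i => w i.+2) (- ((w 0)^-1 * (w 1)^* * k)).
Proof.
case: s => // z s _; set r := size s => gE x0 i j /= ir jr.
have E i' j' := gE x0 i' j'.
rewrite /schur; have := E i.+2 j.+2 ir jr; rewrite /= => ->.
have := E i.+2 1%N ir isT; rewrite /= => ->.
have := E 0%N j.+2 isT jr; rewrite /= => ->.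
have := E i.+2 0%N ir isT; rewrite /= => ->.
have := E 1%N j.+2 isT jr; rewrite /= => ->.
have := E 0%N 1%N isT isT; rewrite /= => ->.
have := E 1%N 0%N isT isT; rewrite /= => ->.
rewrite /closed_path_weight /= !eqSS !andbF !andbT /= -/r.
rewrite rmorphN !rmorphM fmorphV /= !conjCK.
rewrite !mul0r !mul1r !add0r !addr0.
by case: (i == 0%N); case: (j == 0%N); case: (i == r); case: (j == r);
  rewrite /= ?mul0r ?mul1r ?mulr0 ?mulr1 ?subr0 ?addr0 ?sub0r; ring.
Qed.

Lemma setDcons2 u v s : uniq [:: u, v & s] ->
  [set x in [:: u, v & s]] :\: [set u; v] = [set x in s].
Proof.
rewrite /= inE negb_or => /andP[/andP[uv us] /andP[vs _]].
apply/setP => x; rewrite !inE negb_or.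
have [->|xu] := eqVneq x u; first by rewrite (negbTE us).
by have [->|xv] := eqVneq x v; first by rewrite (negbTE vs).
Qed.

Definition unit_weights w := forall i, w i * (w i)^* = 1.

Lemma unit_weights_neq0 w i : unit_weights w -> w i != 0.
Proof. by move=> /(_ i) w1; apply: contra_eq_neq w1 => ->; rewrite mul0r eq_sym oner_eq0. Qed.

Lemma closed_path_step g u v s w k a b :
  herm_form g -> uniq [:: u, v & s] -> (0 < size s)%N ->
  unit_weights w -> closed_path_form g [:: u, v & s] w k ->
  has_inertia (schur g u v) [set x in s] a b ->
  has_inertia g [set x in [:: u, v & s]] a.+1 b.+1.
Proof.
move=> hg us s0 w1 gE.
have w0 := unit_weights_neq0 0 w1.
rewrite -(setDcons2 us).
(* Since [s] is nonempty, the closing weight does not fall on the pair [u], [v], whose entry is thus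
   the nonzero [w 0]. *)
have s1 : (1 == (size s).+1)%N = false by rewrite eqSS; case: (size s) s0.
apply: has_inertia_schur; rewrite ?inE ?eqxx ?orbT //.
- by move: us; rewrite /= inE negb_or => /andP[/andP[]].
- have := gE u 0%N 0%N isT isT; rewrite /= => ->.
  by rewrite /closed_path_weight /= !mul0r !addr0.
- have := gE u 1%N 1%N isT isT; rewrite /= => ->.
  by rewrite /closed_path_weight /= andbF !mul0r !addr0.
- have := gE u 0%N 1%N isT isT; rewrite /= => ->.
  by rewrite /closed_path_weight /= s1 !mul0r !addr0 mul1r.
Qed.

(** The product of the entries around the cycle: over the closing edge from the first vertex to the
    last, then back down the path. *)
Definition closed_path_prod w k n := k * \prod_(i < n) (w i)^*.

(** A unit weight has its conjugate as inverse, so the new closing weight absorbs both removed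
    weights, up to a sign. *)
Lemma closed_path_prod_step w k n : unit_weights w ->
  closed_path_prod (fun i => w i.+2) (- ((w 0%N)^-1 * (w 1%N)^* * k)) n =
  - closed_path_prod w k n.+2.
Proof.
move=> w1; have -> : (w 0%N)^-1 = (w 0%N)^*.
  have w0 := unit_weights_neq0 0 w1.
  by apply: (mulfI w0); rewrite w1 mulfV.
by rewrite /closed_path_prod !big_ord_recl /=; ring.
Qed.

(** Elimination ends with two vertices, where path edge and closing edge overlap in the single entry
    [w 0 + k]. The form there is zero or has inertia (1, 1). *)
Lemma has_inertia_even_cycle n g s w k :
  size s = n.*2.+2 -> uniq s -> herm_form g -> unit_weights w ->
  closed_path_form g s w k ->
  let a := (n + (closed_path_prod w k n.*2.+1 != (-1) ^+ n.+1))%N in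
  has_inertia g [set x in s] a a.
Proof.
elim: n g s w k => [|n IHn] g [|u [|v s]] // w k /=.
  case: s => //= _ us hg w1 gE.
  have guv : g u v = w 0%N + k.
    have := gE u 0%N 1%N isT isT; rewrite /= => ->.
    by rewrite /closed_path_weight /= !mul0r !addr0 !mul1r.
  have guu : g u u = 0.
    have := gE u 0%N 0%N isT isT; rewrite /= => ->.
    by rewrite /closed_path_weight /= !mul0r !addr0.
  have gvv : g v v = 0.
    have := gE u 1%N 1%N isT isT; rewrite /= => ->.
    by rewrite /closed_path_weight /= !mul0r !addr0.
  have w0 := unit_weights_neq0 0 w1.
  (* Multiplying by [w 0] turns the product [k * (w 0)^*] into [k], so it equals -1 exactly when the
     entry vanishes. *)
  have -> : (closed_path_prod w k 1 != (-1) ^+ 1) = (g u v != 0).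
    rewrite guv /closed_path_prod big_ord1 -(inj_eq (mulfI w0)).
    by rewrite mulrCA w1 mulr1 mulrN1 -subr_eq0 opprK addrC.
  have [guv0|guv0] /= := eqVneq (g u v) 0.
    apply: has_inertia0 => x y; rewrite !inE => /orP[]/eqP-> /orP[]/eqP->//.
    by rewrite hg guv0 conjC0.
  apply: (has_inertia_schur hg _ _ _ guu gvv guv0); rewrite ?inE ?eqxx ?orbT //.
    by move: us; rewrite andbT inE.
  by rewrite setDcons2 //; apply: has_inertia0 => x y; rewrite !inE.
rewrite doubleS => -[ss] us hg w1 gE.
have s0 : (0 < size s)%N by rewrite ss.
have us' : uniq s by case/and3P: us.
rewrite addSn; apply: (closed_path_step hg us s0 w1 gE).
have := IHn _ s _ _ ss us' (schur_herm u v hg) (fun i => w1 i.+2) (schur_closed_path s0 gE).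
rewrite closed_path_prod_step // [(-1) ^+ n.+2]exprS mulN1r.
by rewrite -[in X in X -> _](inj_eq oppr_inj) opprK.
Qed.

(** Elimination ends with one vertex, whose diagonal entry is the closing weight plus its conjugate;
    its sign decides the extra eigenvalue. *)
Lemma has_inertia_odd_cycle n g s w k :
  size s = n.*2.+1 -> uniq s -> herm_form g -> unit_weights w ->
  closed_path_form g s w k ->
  let r := (-1) ^+ n * (closed_path_prod w k n.*2 + (closed_path_prod w k n.*2)^*) in
  has_inertia g [set x in s] (n + (0 < r)%R) (n + (r < 0)%R).
Proof.
elim: n g s w k => [|n IHn] g [|u s] // w k /=.
  case: s => //= _ us hg w1 gE.
  have guu : g u u = k + k^*.
    have := gE u 0%N 0%N isT isT; rewrite /= => ->.
    by rewrite /closed_path_weight /= !mul0r !add0r !mul1r.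
  rewrite /closed_path_prod big_ord0 mulr1 expr0 mul1r -guu !add0n.
  have gr : g u u \is Num.real by apply/CrealP; rewrite -hg.
  have -> : (0 < g u u)%R = #|[pred x in [set x in [:: u]] | (0 < g x x)%R]| :> nat.
    rewrite -sum1_card big_mkcond (bigD1 u) //= big1 => [|x xu]; last first.
      by rewrite !inE (negbTE xu).
    by rewrite !inE eqxx addn0; case: (_ < _).
  have -> : (g u u < 0)%R = #|[pred x in [set x in [:: u]] | (g x x < 0)%R]| :> nat.
    rewrite -sum1_card big_mkcond (bigD1 u) //= big1 => [|x xu]; last first.
      by rewrite !inE (negbTE xu).
    by rewrite !inE eqxx addn0; case: (_ < _).
  apply: has_inertia_diag => x; last by rewrite !inE => /eqP->.
  by move=> y; rewrite !inE => /eqP-> /eqP->; rewrite eqxx.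
case: s => [|v s] //; rewrite doubleS => -[ss] us hg w1 gE.
have s0 : (0 < size s)%N by rewrite ss.
have us' : uniq s by case/and3P: us.
rewrite !addSn; apply: (closed_path_step hg us s0 w1 gE).
have := IHn _ s _ _ ss us' (schur_herm u v hg) (fun i => w1 i.+2) (schur_closed_path s0 gE).
rewrite closed_path_prod_step // exprS mulN1r rmorphN /=.
by rewrite -opprD mulrN mulNr.
Qed.

End CycleInertia.

(** * Matchings *)

Section Matchings.
Variables (T : finType) (G : mixedGraph T).
Implicit Types (M N : {set {set T}}) (S V X : {set T}) (e : {set T}) (c : seq T).

Lemma edgesP e : reflect (exists u v, e = [set u; v] /\ madj G u v) (e \in edges G).
Proof.
apply: (iffP imsetP) => [[[u v] /=]|[u [v [-> uv]]]].
  by rewrite inE /= => uv ->; exists u, v.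
by exists (u, v); rewrite ?inE.
Qed.

Lemma mem_edges u v : madj G u v -> [set u; v] \in edges G.
Proof. by move=> uv; apply/edgesP; exists u, v. Qed.

Lemma madj_neq u v : madj G u v -> u != v.
Proof. by move=> uv; apply/eqP => E; rewrite E madj_irr in uv. Qed.

Lemma is_matching0 : is_matching G set0.
Proof. by rewrite /is_matching sub0set; apply/trivIsetP => A B; rewrite inE. Qed.

Lemma leq_matching_number M : is_matching G M -> (#|M| <= matching_number G)%N.
Proof. exact: leq_bigmax_cond. Qed.

Lemma max_matching_exists : exists2 M, is_matching G M & #|M| = matching_number G.
Proof.
have [|M MG E] := @eq_bigmax_cond _ (is_matching G) (fun M => #|M|).
  by apply/card_gt0P; exists set0; apply: is_matching0.
by exists M; last exact: esym E.
Qed.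

Lemma matching_numberE M : is_matching G M ->
  (forall N, is_matching G N -> #|N| <= #|M|)%N -> matching_number G = #|M|.
Proof.
move=> mM maxM; apply/eqP; rewrite eqn_leq leq_matching_number // andbT.
by have [N mN <-] := max_matching_exists; apply: maxM.
Qed.

Lemma is_matchingU M N : is_matching G M -> is_matching G N ->
  [disjoint cover M & cover N] ->
  is_matching G (M :|: N) /\ #|M :|: N| = (#|M| + #|N|)%N.
Proof.
move=> /andP[sM tM] /andP[sN tN] dMN; split.
  by rewrite /is_matching subUset sM sN trivIsetU.
rewrite cardsU; suff -> : M :&: N = set0 by rewrite cards0 subn0.
apply/setP => e; rewrite !inE; apply/negP => /andP[eM eN].
have [u [v [eE _]]] := edgesP e (subsetP sM _ eM).
have ue : u \in e by rewrite eE !inE eqxx.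
have uM : u \in cover M by apply/bigcupP; exists e.
by have /bigcupP[] := disjointFr dMN uM; exists e.
Qed.

Lemma is_matching1 u v : madj G u v -> is_matching G [set [set u; v]].
Proof.
by move=> uv; rewrite /is_matching sub1set mem_edges // trivIset1.
Qed.

(** Weak duality: the edges of a matching are disjoint, so each vertex weight is spent at most
    once. *)
Lemma matching_weight M (f : T -> nat) (h : {set T} -> nat) : is_matching G M ->
  (forall u v, [set u; v] \in M -> madj G u v -> h [set u; v] <= f u + f v)%N ->
  (\sum_(e in M) h e <= \sum_x f x)%N.
Proof.
move=> /andP[sM tM] hf.
apply: (@leq_trans (\sum_(x in cover M) f x)); last first.
  by rewrite [leqRHS](bigID (mem (cover M))) /= leq_addr.
rewrite big_trivIset //=; apply: leq_sum => e eM.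
have [u [v [eE uv]]] := edgesP e (subsetP sM _ eM).
rewrite eE big_setU1 ?big_set1 ?inE ?madj_neq //=; apply: hf => //.
by rewrite -eE.
Qed.

Lemma sum_mem (A : {set T}) : (\sum_x (x \in A) = #|A|)%N.
Proof. by rewrite -sum1_card [RHS]big_mkcond; apply: eq_bigr => x _; case: (x \in A). Qed.

(** Asking [V] to cover only the edges of [M] makes the bound available for matchings that avoid the
    cycle. *)
Lemma matching_cover M V : is_matching G M ->
  (forall u v, [set u; v] \in M -> madj G u v -> (u \in V) || (v \in V)) ->
  (#|M| <= #|V|)%N.
Proof.
move=> mM cV; rewrite -sum_mem -sum1_card.
by apply: matching_weight => // u v uvM /(cV _ _ uvM); case: (u \in V); case: (v \in V).
Qed.

(** Every other edge of the path is taken. *)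
Lemma path_matching s : uniq s -> sorted (madj G) s ->
  exists2 M, is_matching G M & #|M| = (size s)./2 /\ cover M \subset [set x in s].
Proof.
have [n] := ubnP (size s); elim: n s => // n IHn [|a [|b s]] /=.
- by exists set0; rewrite ?is_matching0 ?cards0 ?/cover ?big_set0 ?sub0set.
- by exists set0; rewrite ?is_matching0 ?cards0 ?/cover ?big_set0 ?sub0set.
rewrite inE negb_or !ltnS => sn /andP[/andP[ab as_] /andP[bs us]] /andP[eab pbs].
have [|//||M mM [cM sM]] := IHn s; first by apply: leq_trans sn.
  by case: (s) pbs => //= z s' /andP[].
have dM : [disjoint cover [set [set a; b]] & cover M].
  rewrite cover1; apply/pred0P => x /=; apply/negP => /andP[+ /(subsetP sM)].
  by rewrite !inE => /orP[]/eqP->; rewrite ?(negbTE as_) ?(negbTE bs).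
have [mU cU] := is_matchingU (is_matching1 eab) mM dM.
exists ([set [set a; b]] :|: M) => //; rewrite cU cards1 cM add1n; split=> //.
rewrite /cover bigcup_setU big_set1; apply/subsetP => x; rewrite !inE => /orP[].
  by move/orP=> [] ->; rewrite ?orbT.
by move/(subsetP sM); rewrite inE => ->; rewrite !orbT.
Qed.

Lemma mem_cycle_edges c e z : e \in cycle_edges c -> z \in e -> z \in c.
Proof.
by move/imsetP => [x xc ->]; rewrite !inE => /orP[]/eqP->; rewrite ?mem_next.
Qed.

Lemma cycle_edges_sub c c' z : cycle_edges c = cycle_edges c' -> z \in c -> z \in c'.
Proof.
move=> E zc; apply: (@mem_cycle_edges c' [set z; next c z]); last by rewrite !inE eqxx.
by rewrite -E; apply: imset_f.
Qed.

Lemma next_cat_cons (p1 p2 : seq T) x y : uniq (p1 ++ [:: x, y & p2]) ->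
  next (p1 ++ [:: x, y & p2]) x = y.
Proof.
move=> us; rewrite -(next_rot (size p1) us) rot_size_cat /=.
by rewrite eqxx.
Qed.

(** Equivalently, the two cycle neighbours of a vertex differ, so no vertex of degree one lies on a
    cycle. *)
Lemma next_next_neq c x : uniq c -> (2 < size c)%N -> x \in c -> next c (next c x) != x.
Proof.
move=> us sc xc; have [i s rE] := rot_to xc.
have ss : size (x :: s) = size c by rewrite -rE size_rot.
have us' : uniq (x :: s) by rewrite -rE rot_uniq.
have nE z : next c z = next (x :: s) z by rewrite -rE next_rot.
rewrite !nE; case: s ss us' {rE nE} => [|a [|b s]] /=; try by move=> ss; rewrite -ss in sc.
rewrite eqxx !inE !negb_or => _ /andP[/and3P[xa xb _] _].
by rewrite [a == x]eq_sym (negbTE xa) eqxx eq_sym.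
Qed.

Lemma adj_nextP c :
  {in c &, forall x y, madj G x y -> [set x; y] \in cycle_edges c} ->
  {in c &, forall x y, madj G x y -> y = next c x \/ x = next c y}.
Proof.
move=> cE x y xc yc xy; have /imsetP[z zc E] := cE x y xc yc xy.
have ne := madj_neq xy.
have : x \in [set z; next c z] by rewrite -E !inE eqxx.
have : y \in [set z; next c z] by rewrite -E !inE eqxx orbT.
rewrite !inE => /orP[]/eqP yE /orP[]/eqP xE; rewrite ?xE ?yE; auto.
  by rewrite xE yE eqxx in ne.
by rewrite xE yE eqxx in ne.
Qed.

End Matchings.

(** * Unicyclic graphs without vertices of degree one *)

Section Leafless.
Variables (T : finType) (G : mixedGraph T) (S : {set T}).
Implicit Types (s c p : seq T).

(** Isolated vertices of [S] are allowed; only degree one inside [S] is excluded. *)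
Definition leafless := forall x y, x \in S -> y \in S -> madj G x y ->
  exists2 z, z \in S & (z != y) && madj G x z.

Hypothesis S_leafless : leafless.

Let inS s := {subset s <= S}.

(** The last vertex has a neighbour [w] other than its predecessor. By maximality [w] is on the
    path, and the segment from [w] to the end closes up. *)
Lemma cycle_at_end s : inS s -> uniq s -> sorted (madj G) s -> (1 < size s)%N ->
  (forall p x z, s = rcons p x -> z \in S -> madj G x z -> z \in s) ->
  exists p w q, s = p ++ w :: q /\ is_cycle G (w :: q).
Proof.
move=> sS us ps s2 maxs.
case/lastP: s => [//|s z] in sS us ps s2 maxs *.
case/lastP: s => [//|s z'] in sS us ps s2 maxs *.
have zz' : madj G z' z.
  move: ps; rewrite -!cats1 -catA; case: (s) => [|a s'] /=; first by rewrite andbT.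
  by rewrite cat_path /= => /and3P[_ _ /andP[]].
have z'S : z' \in S by apply: sS; rewrite !(mem_rcons, inE) eqxx orbT.
have zS : z \in S by apply: sS; rewrite !(mem_rcons, inE) eqxx.
have [|w wS /andP[wz' zw]] := S_leafless zS z'S; first by rewrite madj_sym.
have := maxs _ _ _ erefl wS zw; rewrite !(mem_rcons, inE) (negbTE wz') /=.
rewrite eq_sym (negbTE (madj_neq zw)) /= => ws.
case/splitPr: ws => p q in sS us ps s2 maxs *.
exists p, w, (rcons (rcons q z') z); rewrite !rcons_cat /=; split=> //.
move: us ps; rewrite !rcons_cat /= cat_uniq => /and3P[_ _ us] ps.
rewrite /is_cycle /= !size_rcons /= /ucycleb; apply/andP; split=> //.
rewrite /= rcons_path last_rcons zw andbT.
by case: (p) ps => [|a p'] //=; rewrite cat_path /= => /and3P[].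
Qed.

Variables (c : seq T) (hc : is_unique_cycle G c).

(* A path through the edge [x y] that cannot be prolonged closes up into a
   cycle at both of its ends.  Both cycles are [c], so the first vertex of the
   path lies on the cycle at its end, and the path is [c] itself. *)
Lemma maximal_path_is_cycle s : inS s -> uniq s -> sorted (madj G) s -> (1 < size s)%N ->
  (forall p x z, s = rcons p x -> z \in S -> madj G x z -> z \in s) ->
  (forall p x z, s = x :: p -> z \in S -> madj G x z -> z \in s) ->
  is_cycle G s.
Proof.
move=> sS us ps s2 maxe maxb.
have [p [w [q [sE cyc]]]] := cycle_at_end sS us ps s2 maxe.
have [|||||p' [w' [q' [sE' cyc']]]] := @cycle_at_end (rev s).
- by move=> x; rewrite mem_rev; apply: sS.
- by rewrite rev_uniq.
- rewrite rev_sorted; apply: sub_sorted ps => x y /=; by rewrite madj_sym.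
- by rewrite size_rev.
- move=> r x z rE zS xz; rewrite mem_rev; apply: (maxb (rev r) x) => //.
  by rewrite -[s]revK rE rev_rcons.
have E : cycle_edges (w' :: q') = cycle_edges (w :: q).
  by rewrite (hc.2 _ cyc) (hc.2 _ cyc').
case: p => [|a p] in sE *; first by rewrite sE.
have ac : a \in w' :: q'.
  have : last w' (w' :: q') = a.
    rewrite -[a](last_rcons w' (rev (p ++ w :: q))) -rev_cons -cat_cons -sE sE'.
    by rewrite last_cat.
  by move=> <-; apply: (mem_last w' q').
have := cycle_edges_sub E ac; move: us; rewrite sE /= mem_cat negb_or.
by case/andP => /andP[_ /negbTE->].
Qed.

(** Greedy prolongation at both ends, bounded by [#|T|]. [P] carries along what prolongation
    preserves, here the presence of a given edge. *)
Lemma extend_to_maximal s (P : seq T -> Prop) :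
  (forall s z, P s -> P (z :: s)) -> (forall s z, P s -> P (rcons s z)) ->
  P s -> inS s -> uniq s -> sorted (madj G) s ->
  exists s', [/\ P s', inS s', uniq s', sorted (madj G) s' &
   ((forall p x z, s' = rcons p x -> z \in S -> madj G x z -> z \in s') /\
   (forall p x z, s' = x :: p -> z \in S -> madj G x z -> z \in s'))].
Proof.
move=> Pc Pr; have [n] := ubnP (#|T| - size s); elim: n s => // n IHn s sn Ps sS us ps.
have bound z : z \notin s -> (#|T| - (size s).+1 < n)%N.
  move=> zs; have : (size s < #|T|)%N.
    by rewrite -(card_uniqP us) -cardsT; apply/proper_card/properP; split; [apply/subsetP|exists z].
  lia.
have consS z t : z \in S -> inS t -> inS (z :: t).
  by move=> zS tS x; rewrite inE => /orP[/eqP->|/tS].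
case: (pickP [pred z in S | (z \notin s) &&
  (if s is x :: _ then madj G x z else false)]) => [z|noB].
  case/and3P => zS zs; case: s => // x s in sn Ps sS us ps bound zs *; move=> xz.
  apply: (IHn [:: z, x & s]); [exact: bound zs|exact: Pc|exact: consS| |].
    by rewrite /= in us *; rewrite zs us.
  by rewrite /= madj_sym xz.
case: (pickP [pred z in S | (z \notin s) &&
  (if s is x :: p then madj G (last x p) z else false)]) => [z|noE].
  case/and3P => zS zs; case: s => // x s in sn Ps sS us ps bound zs noB *; move=> xz.
  apply: (IHn (rcons (x :: s) z)); [|exact: Pr| | |].
  - by rewrite size_rcons; exact: bound zs.
  - by move=> y; rewrite mem_rcons; apply: consS.
  - by rewrite rcons_uniq zs us.
  - by rewrite /= rcons_path xz andbT.
exists s; split=> //; split=> [p x z sE zS xz|p x z sE zS xz].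
  apply: contraT => zs; have := noE z; rewrite /= zS zs /= sE.
  by case: (p) => [|a p'] /=; rewrite ?last_rcons xz.
by apply: contraT => zs; have := noB z; rewrite /= zS zs /= sE xz.
Qed.

(** A maximal path in [S] through the edge is the whole cycle, with [x] and [y] still consecutive on
    it. *)
Lemma leafless_edge_in_cycle x y : x \in S -> y \in S -> madj G x y ->
  [set x; y] \in cycle_edges c /\ [set z in c] \subset S.
Proof.
move=> xS yS xy.
have [||||||s [[p1 [p2 sE]] sS us ps [maxe maxb]]] :=
    @extend_to_maximal [:: x; y] (fun s => exists p1 p2, s = p1 ++ [:: x, y & p2]).
- by move=> s z [p1 [p2 ->]]; exists (z :: p1), p2.
- by move=> s z [p1 [p2 ->]]; exists p1, (rcons p2 z); rewrite rcons_cat.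
- by exists [::], [::].
- by move=> z; rewrite !inE => /orP[]/eqP->.
- by rewrite /= inE (madj_neq xy).
- by rewrite /= xy.
have s2 : (1 < size s)%N by rewrite sE size_cat /=; lia.
have cyc := maximal_path_is_cycle sS us ps s2 maxe maxb.
have E := hc.2 _ cyc; split.
  rewrite -E; apply/imsetP; exists x; first by rewrite sE mem_cat !inE eqxx orbT.
  by rewrite sE next_cat_cons // -sE.
apply/subsetP => z; rewrite inE => zc; apply: sS.
exact: (cycle_edges_sub (esym E) zc).
Qed.

End Leafless.

(** * Matchings after deletion of vertices *)

Section DeletedMatchings.
Variables (T : finType) (G : mixedGraph T) (X : {set T}).

(** Images under [val] turn matchings of the smaller graph into matchings of [G] away from [X]. This
    and the converse below keep the subtype out of later arguments. *)
Lemma del_matching_number_leq k :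
  (forall N, is_matching G N -> [disjoint cover N & X] -> #|N| <= k)%N ->
  (matching_number (del_vertices G X) <= k)%N.
Proof.
move=> kN; have [M /andP[sM tM] <-] := max_matching_exists (del_vertices G X).
pose im (e : {set {x : T | x \notin X}}) := val @: e.
have im_inj : injective im by apply: imset_inj; apply: val_inj.
rewrite -(card_imset (mem M) im_inj); apply: kN.
  apply/andP; split.
    apply/subsetP => _ /imsetP[e eM ->].
    have [u [v [-> uv]]] := edgesP _ _ (subsetP sM _ eM).
    by rewrite /im imsetU1 imset_set1; apply: mem_edges.
  apply/trivIsetP => _ _ /imsetP[a aM ->] /imsetP[b bM ->] ab.
  rewrite /im imset_disjoint; last exact: val_inj.
  by apply: (trivIsetP tM) => //; apply: contraNneq ab => ->.
apply/pred0P => x /=; apply/negP => /andP[/bigcupP[_ /imsetP[e _ ->] /imsetP[y _ ->]]].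
by rewrite (negbTE (valP y)).
Qed.

Lemma del_matching_number_geq N : is_matching G N -> [disjoint cover N & X] ->
  (#|N| <= matching_number (del_vertices G X))%N.
Proof.
move=> /andP[sN tN] dN.
pose S := {x : T | x \notin X}.
pose pre (e : {set T}) : {set S} := val @^-1: e.
have outX e x : e \in N -> x \in e -> x \notin X.
  move=> eN xe; have xN : x \in cover N by apply/bigcupP; exists e.
  by rewrite (disjointFr dN xN).
have preK : {in N, cancel pre (fun e => val @: e)}.
  move=> e eN; apply/setP => x; apply/imsetP/idP => [[y]|xe].
    by rewrite inE => ye ->.
  by exists (Sub x (outX e x eN xe)); rewrite ?inE SubK.
rewrite -(card_in_imset (can_in_inj preK)); apply: leq_matching_number.
apply/andP; split.
  apply/subsetP => _ /imsetP[e eN ->].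
  have [u [v [eE uv]]] := edgesP _ _ (subsetP sN _ eN).
  have uX : u \notin X by apply: (outX e); rewrite // eE !inE eqxx.
  have vX : v \notin X by apply: (outX e); rewrite // eE !inE eqxx orbT.
  apply/edgesP; exists (Sub u uX), (Sub v vX); split=> //.
  by apply/setP => x; rewrite !inE eE !inE -!val_eqE.
apply/trivIsetP => _ _ /imsetP[a aN ->] /imsetP[b bN ->] ab.
have dab : [disjoint a & b] by apply: (trivIsetP tN) => //; apply: contraNneq ab => ->.
apply/pred0P => x /=; rewrite !inE; apply/negP => /andP[xa].
by rewrite (disjointFr dab xa).
Qed.

End DeletedMatchings.

(** * Entries of the Hermitian adjacency matrix *)

Section HermEntry.
Variables (C : numClosedFieldType) (T : finType) (G : mixedGraph T).
Local Notation g := (herm_entry G C).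

Lemma herm_entry_eq0 x y : (g x y == 0) = ~~ madj G x y.
Proof.
rewrite /herm_entry; case: ifP => [/marc_adj->|_]; first by rewrite (negbTE (neq0Ci C)).
case: ifP => [/marc_adj|_]; first by rewrite madj_sym oppr_eq0 => ->; rewrite (negbTE (neq0Ci C)).
by case: ifP; rewrite ?oner_eq0 ?eqxx.
Qed.

Lemma herm_entry0 x y : ~~ madj G x y -> g x y = 0.
Proof. by rewrite -herm_entry_eq0 => /eqP. Qed.

Lemma herm_entry_diag x : g x x = 0.
Proof. by rewrite herm_entry0 // madj_irr. Qed.

Lemma herm_entry_herm : herm_form g.
Proof.
move=> x y; rewrite /herm_entry madj_sym.
case: ifP => [/marc_asym/negbTE->|_]; first by rewrite rmorphN /= conjCi opprK.
by case: ifP => _; rewrite ?conjCi //; case: ifP => _; rewrite ?rmorph1 ?rmorph0.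
Qed.

Lemma herm_entry_norm x y : madj G x y -> g x y * (g x y)^* = 1.
Proof.
rewrite -normCK /herm_entry => ->; case: ifP => _; first by rewrite normCi expr1n.
by case: ifP => _; rewrite ?normrN ?normCi ?normr1 expr1n.
Qed.

End HermEntry.

(** * Removing vertices of degree one *)

Section Pruning.
Variables (C : numClosedFieldType) (T : finType) (G : mixedGraph T) (c : seq T).
Local Notation g := (herm_entry G C).

(* The state reached after repeatedly removing a vertex of degree one with its
   neighbour: [S] is what remains, [V] collects the removed neighbours and [M]
   the removed pairs. *)
Record pruned (S V : {set T}) (M : {set {set T}}) : Prop := Pruned {
  pruned_inertia : forall a b, has_inertia g S a b ->
    has_inertia g setT (a + #|V|) (b + #|V|);
  pruned_edge : forall x y, madj G x y ->
    [|| x \in V, y \in V | (x \in S) && (y \in S)];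
  pruned_matching : is_matching G M;
  pruned_card : #|M| = #|V|;
  pruned_coverM : [disjoint cover M & S];
  pruned_V : [disjoint V & S];
  pruned_incident : [set x in c] \subset S \/
    exists2 e, e \in M & incident_to_cycle G c e }.

Lemma pruned_setT : pruned setT set0 set0.
Proof.
split; first by move=> a b; rewrite cards0 !addn0.
- by move=> x y _; rewrite !inE.
- exact: is_matching0.
- by rewrite !cards0.
- by rewrite /cover big_set0 -setI_eq0 set0I.
- by rewrite -setI_eq0 set0I.
- by left; apply: subsetT.
Qed.

(** On the remaining vertices the row of [u] vanishes, so the Schur correction is zero and the form
    is unchanged. *)
Lemma pruned_step S V M u v : is_cycle G c -> pruned S V M ->
  u \in S -> v \in S -> madj G u v -> {in S, forall y, madj G u y -> y = v} ->
  pruned (S :\: [set u; v]) (v |: V) ([set u; v] |: M).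
Proof.
move=> cyc [pI pE pM pC pcM pV pJ] uS vS uv leaf.
have ne := madj_neq uv.
have vV : v \notin V by rewrite (disjointFl pV vS).
have cardV : #|v |: V| = #|V|.+1 by rewrite cardsU1 vV.
have gu0 x : x \in S :\: [set u; v] -> g x u = 0 /\ g u x = 0.
  rewrite !inE negb_or => /andP[/andP[xu xv] xS].
  have nux : ~~ madj G u x by apply: contra xv => /(leaf _ xS)->.
  by split; apply: herm_entry0; rewrite // madj_sym.
have dM : [disjoint cover [set [set u; v]] & cover M].
  rewrite cover1; apply/pred0P => x /=; rewrite !inE; apply/negP => /andP[+ xM].
  by have := disjointFr pcM xM; move=> xS /orP[]/eqP E; rewrite E ?uS ?vS in xS.
have [mU cU] := is_matchingU (is_matching1 uv) pM dM.
split=> //.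
- move=> a b gI; rewrite cardV !addnS -!addSn; apply: pI.
  have guv : g u v != 0 by rewrite herm_entry_eq0 uv.
  apply: (has_inertia_schur (@herm_entry_herm C T G) ne uS vS _ _ guv);
    rewrite ?herm_entry_diag //.
  apply: eq_has_inertia gI => x y xS yS.
  have [xu _] := gu0 x xS; have [_ uy] := gu0 y yS.
  by rewrite /schur xu uy mulr0 !mul0r !subr0.
- move=> x y xy; rewrite !inE; have := pE x y xy.
  case/or3P => [->|->|/andP[xS yS]]; rewrite ?orbT // xS yS !andbT.
  have [->|xv] //= := eqVneq x v; have [->|yv] /= := eqVneq y v; first by rewrite orbT.
  have [xu|xu] := eqVneq x u; first by rewrite xu in xy; rewrite (leaf _ yS xy) eqxx in yv.
  have [yu|yu] := eqVneq y u; last by rewrite !orbT.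
  by rewrite yu madj_sym in xy; rewrite (leaf _ xS xy) eqxx in xv.
- by rewrite cU cards1 pC cardV.
- rewrite /cover bigcup_setU big_set1 -setI_eq0; apply/eqP/setP => x; rewrite !inE negb_or.
  apply/negP => /and3P[/orP[xuv|xM] /andP[xu xv] xS].
    by move: xuv; rewrite (negbTE xu) (negbTE xv).
  by rewrite (disjointFr pcM xM) in xS.
- rewrite -setI_eq0; apply/eqP/setP => x; rewrite !inE negb_or.
  apply/negP => /and3P[/orP[xv'|xV] /andP[xu xv] xS].
    by rewrite xv' in xv.
  by rewrite (disjointFr pV xV) in xS.
case: pJ => [cS|[e eM ec]]; last by right; exists e; rewrite // !inE eM orbT.
have /andP[sc /andP[cc uc]] := cyc.
have inS x : x \in c -> x \in S by move=> xc; apply: (subsetP cS); rewrite inE.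
(* On the cycle, [u] would have [v] both as successor and as predecessor. So either [v] is on the
   cycle and the removed pair is incident to it, or the cycle survives intact. *)
have ucn : u \notin c.
  apply/negP => xc.
  have nu : next c u = v by apply: leaf; [apply: inS; rewrite mem_next|apply: next_cycle].
  have pu : prev c u = v.
    by apply: leaf; [apply: inS; rewrite mem_prev|rewrite madj_sym; apply: prev_cycle].
  by have := next_next_neq uc sc xc; rewrite nu -pu next_prev ?eqxx.
have [vc|vc] := boolP (v \in c); [right|left].
  exists [set u; v]; first by rewrite !inE eqxx.
  rewrite /incident_to_cycle mem_edges //=; apply/cards1P; exists v.
  apply/setP => x; rewrite !inE; have [->|xv] := eqVneq x v; first by rewrite vc orbT.
  by rewrite orbF; apply/negP => /andP[/eqP->]; rewrite (negbTE ucn).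
apply/subsetP => x; rewrite !inE => xc; rewrite inS // andbT.
by apply/norP; split; [apply: contraNneq ucn => <-|apply: contraNneq vc => <-].
Qed.

Lemma pruned_leafless : is_cycle G c ->
  exists S V M, pruned S V M /\ leafless G S.
Proof.
move=> cyc; suff: forall S V M, pruned S V M -> exists S V M, pruned S V M /\ leafless G S.
  by apply; apply: pruned_setT.
move=> S; have [n] := ubnP #|S|; elim: n S => // n IHn S Sn V M pS.
case: (pickP [pred u in S | [exists v in S,
  madj G u v && [forall y in S, madj G u y ==> (y == v)]]]) => [u|noleaf].
  case/andP => uS /exists_inP[v vS /andP[uv /forall_inP leaf]].
  have leaf' : {in S, forall y, madj G u y -> y = v}.
    by move=> y yS uy; apply/eqP; apply: (implyP (leaf y yS)).
  apply: (IHn _ _ _ _ (pruned_step cyc pS uS vS uv leaf')).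
  rewrite -ltnS (leq_trans _ Sn) // ltnS; apply: proper_card; apply/properP.
  by split; [apply: subsetDl|exists u; rewrite ?inE ?eqxx].
exists S, V, M; split=> // x y xS yS xy.
have := noleaf x; rewrite /= xS /= => /negbT; rewrite negb_exists_in => /forall_inP/(_ y yS).
rewrite xy /= negb_forall_in => /exists_inP[z zS]; rewrite negb_imply => /andP[xz zy].
by exists z; rewrite // zy.
Qed.

End Pruning.

(** * The weight of the cycle in terms of its signature *)

Section CycleWeight.
Variables (C : numClosedFieldType) (T : finType) (G : mixedGraph T).
Local Notation g := (herm_entry G C).

Lemma prod_herm_entry (l : seq T) (nx : T -> T) : {in l, forall x, madj G x (nx x)} ->
  \prod_(x <- l) g x (nx x) =
  'i ^+ count (fun x => marc G x (nx x)) l * (- 'i) ^+ count (fun x => marc G (nx x) x) l.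
Proof.
elim: l => [|x l IHl] lE; first by rewrite big_nil mulr1.
rewrite big_cons IHl => [|y yl]; last by apply: lE; rewrite inE yl orbT.
rewrite /= /herm_entry lE ?inE ?eqxx //.
case: ifP => [/marc_asym/negbTE->|_]; first by rewrite add0n exprS mulrA.
by case: ifP => _; rewrite ?add0n ?mul1r // exprS mulrCA.
Qed.

Variables (c : seq T) (cyc : is_cycle G c).

(** Forward arcs give ['i] and backward arcs [- 'i]; they cancel in pairs, leaving a power of
    whichever kind is in excess. *)
Lemma prod_cycle_weight : exists2 z : C, z = 'i \/ z = - 'i &
  \prod_(x <- c) g x (next c x) = z ^+ signature G c.
Proof.
have /andP[_ /andP[cc _]] := cyc.
rewrite prod_herm_entry => [|x xc]; last exact: next_cycle.
rewrite /signature -/(forward_arcs G c) -/(backward_arcs G c).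
set f := forward_arcs G c; set b := backward_arcs G c.
have [fb|/ltnW bf] := leqP b f.
  exists 'i; [by left|]; have -> : `|f%:Z - b%:Z|%N = (f - b)%N by lia.
  rewrite -[X in 'i ^+ X * _](subnK fb) exprD -mulrA -exprMn mulrN -expr2 sqrCi opprK.
  by rewrite expr1n mulr1.
exists (- 'i); [by right|]; have -> : `|f%:Z - b%:Z|%N = (b - f)%N by lia.
rewrite -[X in _ * _ ^+ X = _](subnK bf) exprD mulrCA -exprMn mulrN -expr2 sqrCi opprK.
by rewrite expr1n mulr1.
Qed.

Lemma signature_leq : (signature G c <= size c)%N.
Proof.
have fq : (forward_arcs G c <= size c)%N by apply: count_size.
have bq : (backward_arcs G c <= size c)%N by apply: count_size.
by rewrite /signature; lia.
Qed.

(* Conjugated because the closing weight of the path runs from its first vertex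
   to its last, against the traversal of the cycle. *)
Definition cycle_weight : C := (\prod_(x <- c) g x (next c x))^*.

Lemma cycle_weight_even : ~~ odd (signature G c) ->
  cycle_weight = (-1) ^+ (signature G c)./2.
Proof.
rewrite /cycle_weight => ev; have [z zi ->] := prod_cycle_weight.
rewrite -{1}[signature G c]odd_double_half (negbTE ev) add0n -mul2n exprM.
have -> : z ^+ 2 = -1 by case: zi => ->; rewrite ?sqrrN sqrCi.
by rewrite rmorphXn rmorphN1.
Qed.

Lemma cycle_weight_odd : odd (signature G c) -> cycle_weight + cycle_weight^* = 0.
Proof.
move=> ev; rewrite /cycle_weight; have [z zi ->] := prod_cycle_weight.
have zc : z^* = - z by case: zi => ->; rewrite ?rmorphN /= conjCi.
by rewrite conjCK rmorphXn /= zc exprNn -signr_odd ev expr1 mulN1r addNr.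
Qed.

(** An odd signature makes the weight imaginary, hence not a sign. For an even one, equal parity of
    [s./2] and [n.+1] means that [s] and [q] agree modulo 4. *)
Lemma cycle_weight_eq n : size c = n.*2.+2 ->
  (cycle_weight != (-1) ^+ n.+1) =
  ~~ (~~ odd (signature G c) && (`|(signature G c)%:Z - (size c)%:Z|%N == 0 %[mod 4])).
Proof.
move=> qE; congr (~~ _); have [od|ev] /= := boolP (odd (signature G c)).
  apply/negbTE/eqP => wE; have /eqP := cycle_weight_odd od.
  by rewrite wE rmorphXn rmorphN1 -mulr2n mulrn_eq0 signr_eq0.
rewrite cycle_weight_even // -signr_odd -[X in _ == X]signr_odd (inj_eq (@signr_inj _)).
by have := signature_leq; rewrite qE; move: (signature G c) ev => s ev sle; lia.
Qed.

(** For even signature s, [r] is twice the sign (-1)^(n + s/2). The bound s <= q matters: it makes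
    the distance q - s, whereas negation would exchange the residues 1 and 3. *)
Lemma cycle_weight_sign n : size c = n.*2.+1 ->
  let r := (-1) ^+ n * (cycle_weight + cycle_weight^*) in
  let d := `|(signature G c)%:Z - (size c)%:Z|%N in
  (0 < r) = (~~ odd (signature G c) && (d == 1 %[mod 4])) /\
  (r < 0) = (~~ odd (signature G c) && (d == 3 %[mod 4])).
Proof.
move=> qE r d; rewrite /r; have [od|ev] /= := boolP (odd (signature G c)).
  by rewrite cycle_weight_odd // mulr0 ltxx.
rewrite cycle_weight_even // rmorphXn rmorphN1 -mulr2n mulrnAr -exprD -signr_odd.
rewrite pmulrn_lgt0 // pmulrn_llt0 // /d.
have := signature_leq; rewrite qE; move: (signature G c) ev => s ev sle.
have [od|ev'] := boolP (odd (n + s./2)); rewrite ?expr0 ?expr1.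
  by rewrite ltrN10 oppr_gt0 ltr10; split; lia.
by rewrite ltr01 ltr10; split; lia.
Qed.

Lemma cycle_closed_path_form :
  {in c &, forall x y, madj G x y -> [set x; y] \in cycle_edges c} ->
  exists w k, [/\ unit_weights w, closed_path_form g c w k &
    closed_path_prod w k (size c).-1 = cycle_weight].
Proof.
move=> cE; have /andP[c2 /andP[cc uc]] := cyc.
case cyp: c => [|y p]; first by rewrite cyp in c2.
rewrite -cyp; pose e i := nth y c i.
have qE : size c = (size p).+1 by rewrite cyp.
have nextE i : (i < size c)%N -> next c (e i) = nth y p i.
  move=> iq; rewrite next_nth mem_nth // {1}cyp /e index_uniq //.
have nextS i : (i < size p)%N -> next c (e i) = e i.+1.
  by move=> ip; rewrite nextE ?qE 1?ltnW // /e cyp.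
have nextL : next c (e (size p)) = e 0%N.
  by rewrite nextE ?qE // nth_default // /e cyp.
(* The value 1 past the end of the path keeps all weights of modulus one. *)
pose w i := if (i < size p)%N then g (e i) (e i.+1) else 1.
have ec i : (i < size c)%N -> e i \in c by apply: mem_nth.
exists w, (g (e 0%N) (e (size p))); split.
- move=> i; rewrite /w; case: ifP => ip; last by rewrite rmorph1 mulr1.
  by apply: herm_entry_norm; rewrite -nextS //; apply: next_cycle => //; apply: ec; rewrite qE ltnW.
- move=> x0 i j iq jq; rewrite !(set_nth_default y x0) // -/(e i) -/(e j).
  have p1 : (1 < size p)%N by rewrite qE in c2.
  rewrite /closed_path_weight qE /=.
  have eI i' j' : (i' < size c)%N -> (j' < size c)%N -> e i' = e j' -> i' = j'.
    by move=> iq' jq' /eqP; rewrite nth_uniq // => /eqP.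
  have [jE|ji] := eqVneq j i.+1.
    have -> : (i == j.+1) = false by lia.
    have -> : (i == 0%N) && (j == size p) = false by lia.
    have -> : (j == 0%N) = false by lia.
    by rewrite andbF !mul0r !addr0 mul1r /w jE -ltnS -qE -jE jq.
  have [iE|ij] := eqVneq i j.+1.
    have -> : (i == 0%N) && (j == size p) = false by lia.
    have -> : (i == size p) && (j == 0%N) = false by lia.
    by rewrite !mul0r !addr0 mul1r add0r /w iE -ltnS -qE -iE iq -herm_entry_herm.
  rewrite !mul0r add0r add0r.
  have [/andP[/eqP-> /eqP->]|n1] := boolP ((i == 0%N) && (j == size p)).
    have -> : (0%N == size p) && (size p == 0%N) = false by lia.
    by rewrite mul0r addr0 mul1r.
  have [/andP[/eqP-> /eqP->]|n2] := boolP ((i == size p) && (j == 0%N)).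
    by rewrite mul0r add0r mul1r -herm_entry_herm.
  rewrite !mul0r addr0; apply: herm_entry0; apply/negP => eij.
  (* As the cycle has no chord, adjacent positions are consecutive or are the last and the first,
     which are already treated. *)
  have nextI a b : (a < size c)%N -> (b < size c)%N -> e b = next c (e a) ->
      b = a.+1 \/ (a = size p /\ b = 0%N).
    move=> aq bq; have [ap|pa] := ltnP a (size p).
      by rewrite nextS // => E; left; apply: eI; rewrite // qE.
    have -> : a = size p by lia.
    by rewrite nextL => E; right; split=> //; apply: eI; rewrite // qE.
  have [/(nextI _ _ iq jq)|/(nextI _ _ jq iq)] := adj_nextP cE (ec _ iq) (ec _ jq) eij.
    by case=> [E|[E E']]; [rewrite E eqxx in ji|rewrite E E' !eqxx in n2].
  by case=> [E|[E E']]; [rewrite E eqxx in ij|rewrite E E' !eqxx in n1].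
(* The last factor of the cycle product, from the last vertex to the first, is conjugate to the
   closing weight. *)
rewrite /closed_path_prod /cycle_weight (big_nth y) qE /= big_mkord big_ord_recr /=.
rewrite rmorphM /= -/(e (size p)) nextL -herm_entry_herm mulrC rmorph_prod.
congr (_ * _); apply: eq_bigr => i _.
by rewrite -/(e i) nextS ?ltn_ord // /w ltn_ord.
Qed.

End CycleWeight.

(** * The two outcomes of the pruning *)

Section Cases.
Variables (C : numClosedFieldType) (T : finType) (G : mixedGraph T) (c : seq T).
Hypothesis cyc : is_cycle G c.
Variables (S V : {set T}) (M : {set {set T}}).
Hypothesis pr : pruned C G c S V M.

Let cycle_in : cycle (madj G) c. Proof. by case/andP: cyc => _ /andP[]. Qed.
Let cycle_uniq : uniq c. Proof. by case/andP: cyc => _ /andP[]. Qed.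
Let cycle_size : (2 < size c)%N. Proof. by case/andP: cyc. Qed.
Let cS := [set x in c].

Lemma card_cycle_set : #|cS| = size c.
Proof. by rewrite cardsE; apply/card_uniqP. Qed.

Section NoEdgeLeft.
Hypothesis S0 : {in S &, forall x y, ~~ madj G x y}.

Let V_cover x y : madj G x y -> (x \in V) || (y \in V).
Proof.
by move=> xy; case/or3P: (pruned_edge pr xy) => [->|->|/andP[/S0 xS /xS]]; rewrite ?orbT ?xy.
Qed.

Lemma matching_number_no_edge : matching_number G = #|V|.
Proof.
rewrite -(pruned_card pr); apply: matching_numberE (pruned_matching pr) _ => N mN.
by rewrite (pruned_card pr); apply: (matching_cover mN) => u v _; apply: V_cover.
Qed.

(** The cycle cannot survive in an edgeless [S], so the maximum matching [M] contains an incident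
    edge. *)
Lemma not_avoid_no_edge : ~~ max_matchings_avoid_incident G c.
Proof.
case: (pruned_incident pr) => [cS'|[e eM ec]].
  case cE: c cS' cycle_in cycle_size => [|x p] //= cS' pc _.
  have xc : x \in c by rewrite cE inE eqxx.
  have xS : x \in S by apply: (subsetP cS'); rewrite !inE eqxx.
  have nS : next c x \in S by apply: (subsetP cS'); rewrite inE -cE mem_next.
  by have := S0 xS nS; rewrite (next_cycle cycle_in xc).
rewrite /max_matchings_avoid_incident negb_forall_in; apply/exists_inP; exists M.
  rewrite /is_max_matching (pruned_matching pr) matching_number_no_edge.
  by rewrite (pruned_card pr) eqxx.
by rewrite negb_forall_in; apply/exists_inP; exists e; rewrite // negbK.
Qed.

(** Each cycle vertex or its successor lies in [V], and the successor map is injective on the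
    cycle. *)
Lemma cycle_size_leq_cover : (size c <= #|cS :&: V|.*2)%N.
Proof.
rewrite -card_cycle_set -addnn.
pose D := [set x in cS | next c x \in V].
have DV : (#|D| <= #|cS :&: V|)%N.
  rewrite -(card_imset (mem D) (can_inj (prev_next cycle_uniq))).
  apply/subset_leq_card/subsetP => _ /imsetP[x + ->].
  by rewrite !inE mem_next.
apply: leq_trans (leq_add (leqnn _) DV); apply: leq_trans (leq_card_setU _ _).
apply/subset_leq_card/subsetP => x; rewrite !inE => xc; rewrite xc /=.
by apply: V_cover; apply: next_cycle.
Qed.

(** The part of [V] off the cycle covers all edges avoiding the cycle. *)
Lemma del_matching_number_no_edge :
  (matching_number (del_vertices G cS) + #|cS :&: V| <= #|V|)%N.
Proof.
rewrite -[leqRHS](cardsID cS V) addnC setIC leq_add2l.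
apply: del_matching_number_leq => N mN dN; apply: (matching_cover mN) => u v uvN uv.
have out x : x \in [set u; v] -> x \notin c.
  move=> xuv; have xN : x \in cover N by apply/bigcupP; exists [set u; v].
  by have := disjointFr dN xN; rewrite inE => ->.
have uc : u \notin c by apply: out; rewrite !inE eqxx.
have vc : v \notin c by apply: out; rewrite !inE eqxx orbT.
by rewrite !inE uc vc; apply: V_cover.
Qed.

Lemma inertia_no_edge :
  num_pos_eig (herm_adj G C) = #|V| /\ num_neg_eig (herm_adj G C) = #|V|.
Proof.
apply: (@has_inertia_setT C T (herm_entry G C)).
apply: (pruned_inertia pr (a := 0%N) (b := 0%N)).
by apply: has_inertia0 => x y xS yS; apply: herm_entry0; apply: S0.
Qed.

End NoEdgeLeft.

Section CycleLeft.
Hypothesis cycleS : cS \subset S.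
Hypothesis S_edges : {in S &, forall x y, madj G x y -> [set x; y] \in cycle_edges c}.

Let inS x : x \in c -> x \in S.
Proof. by move=> xc; apply: (subsetP cycleS); rewrite inE. Qed.

Let V_out x : x \in V -> x \notin c.
Proof. by move=> xV; apply/negP => /inS; rewrite (disjointFr (pruned_V pr) xV). Qed.

Let edge_cases x y : madj G x y -> [|| x \in V, y \in V | (x \in c) && (y \in c)].
Proof.
move=> xy; case/or3P: (pruned_edge pr xy) => [->|->|/andP[xS yS]]; rewrite ?orbT //.
have xyc := S_edges xS yS xy.
by rewrite !(mem_cycle_edges xyc) ?orbT // !inE eqxx ?orbT.
Qed.

Let weight x := ((x \in V).*2 + (x \in cS))%N.

Let sum_weight : (\sum_x weight x = #|V|.*2 + size c)%N.
Proof.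
rewrite /weight big_split /= sum_mem card_cycle_set; congr (_ + _)%N.
rewrite -sum_mem -mul2n big_distrr /=; apply: eq_bigr => x _.
by rewrite mul2n.
Qed.

Let matching_bound N : is_matching G N -> (#|N|.*2 <= #|V|.*2 + size c)%N.
Proof.
move=> mN; rewrite -sum_weight -muln2 -sum_nat_const.
apply: (matching_weight mN) => u v _ /edge_cases.
rewrite /weight !inE; case: (u \in V); case: (v \in V) => //=; lia.
Qed.

(** Every edge has weight at least 2, which bounds any matching; [M] together with alternate edges
    of the cycle attains the bound. *)
Lemma matching_number_cycle : matching_number G = (#|V| + (size c)./2)%N.
Proof.
have ps : sorted (madj G) c.
  by case: (c) cycle_in => //= x p; rewrite rcons_path => /andP[].
have [N mN [cN sN]] := path_matching cycle_uniq ps.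
have dMN : [disjoint cover M & cover N].
  by apply: disjointWr (subset_trans sN cycleS) (pruned_coverM pr).
have [mU cU] := is_matchingU (pruned_matching pr) mN dMN.
rewrite -(pruned_card pr) -cN -cU; apply: matching_numberE => // N' /matching_bound.
by rewrite cU cN (pruned_card pr); move: #|V| #|N'| (size c) => *; lia.
Qed.

Lemma del_matching_number_cycle : matching_number (del_vertices G cS) = #|V|.
Proof.
apply/eqP; rewrite eqn_leq; apply/andP; split; last first.
  rewrite -(pruned_card pr); apply: del_matching_number_geq (pruned_matching pr) _.
  exact: disjointWr cycleS (pruned_coverM pr).
apply: del_matching_number_leq => N mN dN; apply: (matching_cover mN) => u v uvN uv.
have uc : u \notin c.
  have uN : u \in cover N by apply/bigcupP; exists [set u; v]; rewrite ?inE ?eqxx.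
  by have := disjointFr dN uN; rewrite inE => ->.
by have := edge_cases uv; rewrite (negbTE uc) orbF.
Qed.

(** For even length a maximum matching spends the total weight exactly at 2 per edge. An incident
    edge joins [V] to the cycle and would cost 3. *)
Lemma avoid_cycle : ~~ odd (size c) -> max_matchings_avoid_incident G c.
Proof.
move=> ev; apply/forall_inP => N /andP[mN /eqP cN]; apply/forall_inP => e eN.
apply/negP => /andP[eG ec].
have : (\sum_(e' in N) (2 + (e' == e)) <= \sum_x weight x)%N.
  apply: (matching_weight mN) => u v uvN uv.
  have := edge_cases uv; case: eqP => [E|_]; last first.
    by rewrite /weight !inE; case: (u \in V); case: (v \in V) => //=; lia.
  have V_out' x : ~~ ((x \in V) && (x \in c)).
    by apply/andP => -[/V_out/negbTE->].
  have := V_out' u; have := V_out' v.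
  have : (u \in c) != (v \in c).
    apply: contraTneq ec => E'; rewrite -E; case vc: (v \in c) E' => uc.
      have -> : [set u; v] :&: [set x in c] = [set u; v].
        by apply/setIidPl/subsetP => x; rewrite !inE => /orP[]/eqP->.
      by rewrite cards2 (madj_neq uv).
    have -> : [set u; v] :&: [set x in c] = set0; last by rewrite cards0.
    by apply/setP => x; rewrite !inE; apply/negP => /andP[/orP[]/eqP->]; rewrite ?uc ?vc.
  by rewrite /weight !inE; case: (u \in V); case: (v \in V); case: (u \in c); case: (v \in c).
rewrite sum_weight big_split /= sum_nat_const (bigD1 e) //= eqxx cN.
rewrite matching_number_cycle; move: ev; lia.
Qed.

Lemma inertia_cycle a b : has_inertia (herm_entry G C) cS a b ->
  num_pos_eig (herm_adj G C) = (a + #|V|)%N /\ num_neg_eig (herm_adj G C) = (b + #|V|)%N.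
Proof.
move=> gI; apply: (@has_inertia_setT C T (herm_entry G C)).
apply: (pruned_inertia pr); apply: has_inertia_widen gI => // x.
rewrite !inE => /andP[xc xS] y yS.
have nxy : ~~ madj G x y.
  by apply: contra xc => /(S_edges xS yS)/mem_cycle_edges; apply; rewrite !inE eqxx.
by split; apply: herm_entry0; rewrite // madj_sym.
Qed.

End CycleLeft.
End Cases.

Theorem theorem3p5 (C : numClosedFieldType) (T : finType) (G : mixedGraph T)
    (c : seq T) (hc : is_unique_cycle G c) :
  let q := size c in
  let s := signature G c in
  let d := `|s%:Z - q%:Z|%N in
  let m := matching_number G in
  let mC := matching_number (del_vertices G [set x in c]) in
  (num_pos_eig (herm_adj G C), num_neg_eig (herm_adj G C)) =
  (if [&& ~~ odd q, ~~ odd s, d == 0 %[mod 4] & max_matchings_avoid_incident G c]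
   then (m - 1, m - 1)
   else if [&& odd q, ~~ odd s, d == 1 %[mod 4] & m == mC + (q - 1) %/ 2]
   then (m + 1, m)
   else if [&& odd q, ~~ odd s, d == 3 %[mod 4] & m == mC + (q - 1) %/ 2]
   then (m, m + 1)
   else (m, m))%N.
Proof.
move=> q s d m mC; have cyc := hc.1.
have [S [V [M [pr lf]]]] := @pruned_leafless C T G c cyc.
case: (pickP [pred u : T * T | [&& u.1 \in S, u.2 \in S & madj G u.1 u.2]])
  => [[x y]|noE]; last first.
  have S0 : {in S &, forall x y, ~~ madj G x y}.
    by move=> x y xS yS; have := noE (x, y); rewrite /= xS yS /= => ->.
  have [-> ->] := inertia_no_edge pr S0.
  have mE : m = #|V| := matching_number_no_edge pr S0.
  have qV := cycle_size_leq_cover cyc pr S0.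
  have mCV := del_matching_number_no_edge pr S0.
  rewrite (negbTE (not_avoid_no_edge cyc pr S0)) !andbF mE.
  have [oq|] //= := boolP (odd q).
  (* For odd q, [qV] puts at least (q + 1)/2 cycle vertices in [V], so by [mCV] the required
     equality falls short. *)
  have -> : (#|V| == mC + (q - 1) %/ 2)%N = false.
    by apply/negbTE/eqP; move: oq qV mCV; rewrite -/mC -/q; lia.
  by rewrite !andbF.
case/and3P => /= xS yS xy.
have [_ cycS] := leafless_edge_in_cycle lf hc xS yS xy.
have S_edges : {in S &, forall x y, madj G x y -> [set x; y] \in cycle_edges c}.
  by move=> u v uS vS uv; have [] := leafless_edge_in_cycle lf hc uS vS uv.
have mE : m = (#|V| + q./2)%N := matching_number_cycle cyc pr cycS S_edges.
have mCE : mC = #|V| := del_matching_number_cycle pr cycS S_edges.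
have uc : uniq c by case/andP: cyc => _ /andP[].
have q2 : (2 < q)%N by case/andP: cyc.
have c_edges : {in c &, forall x y, madj G x y -> [set x; y] \in cycle_edges c}.
  by move=> u v uin vin; apply: S_edges; apply: (subsetP cycS); rewrite inE.
have [w [k [w1 wk wE]]] := cycle_closed_path_form C cyc c_edges.
have [oq|eq] /= := boolP (odd q).
  have qE : q = q./2.*2.+1 by rewrite -[LHS]odd_double_half oq.
  have gI := has_inertia_odd_cycle qE uc (@herm_entry_herm C T G) w1 wk.
  have [-> ->] := inertia_cycle pr cycS S_edges gI.
  have -> : closed_path_prod w k q./2.*2 = cycle_weight C G c by rewrite -wE -/q {2}qE.
  have [-> ->] := cycle_weight_sign C cyc qE.
  rewrite -/s -/q -/d mE mCE.
  have -> : (#|V| + q./2 == #|V| + (q - 1) %/ 2)%N by apply/eqP; lia.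
  rewrite !andbT; case: (boolP (odd s)) => [|_] /=; first by rewrite addn0 addnC.
  case: (boolP (d == 1 %[mod 4])) => [d1|_] /=.
    have -> : (d == 3 %[mod 4]) = false by apply/negbTE; lia.
    by rewrite !addn0; congr (_, _); lia.
  by case: (d == 3 %[mod 4]); congr (_, _); lia.
(* The even cycle lemma counts elimination steps down to two vertices, hence the predecessor. *)
have qE : q = (q./2).-1.*2.+2 by lia.
have gI := has_inertia_even_cycle qE uc (@herm_entry_herm C T G) w1 wk.
have [-> ->] := inertia_cycle pr cycS S_edges gI.
have -> : closed_path_prod w k (q./2).-1.*2.+1 = cycle_weight C G c by rewrite -wE -/q {2}qE.
rewrite (cycle_weight_eq C cyc qE) -/s -/q -/d (avoid_cycle cyc pr cycS S_edges eq) andbT mE.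
by case: (~~ odd s && _); congr (_, _); move: qE; lia.
Qed.
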